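(* Let $\sigma\ge2$ be an integer, let $C$ be the invasion percolation cluster on $\mathcal{T}_\sigma$ (with expectation $\mathbb{E}$), and let $C[0,n]$ be the number of vertices of $C$ at heights $0,1,\dots,n$. Then $$\sup_{n\in\mathbb{N}}\mathbb{E}\left(\frac{n^2}{C[0,n]}\right)<\infty.$$
   Context: $\mathcal{T}_\sigma$ is the infinite rooted tree in which every vertex has exactly $\sigma$ children, with root $o$; the height of a vertex is its graph distance from $o$. Invasion percolation cluster: assign i.i.d. uniform $(0,1)$ weights to the edges of $\mathcal{T}_\sigma$. Let $I_0=\{o\}$ and, given $I_N$, let $I_{N+1}$ be obtained by adjoining to $I_N$ the edge in its boundary (edges with exactly one endpoint in $I_N$) with smallest weight, together with its other endpoint. Then $C=\bigcup_{N\ge 0} I_N$. *)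

(* Defs.v *)
From mathcomp Require Import all_boot all_order all_algebra finmap.
From mathcomp Require Import all_classical all_reals all_analysis.

Set Implicit Arguments.
Unset Strict Implicit.
Unset Printing Implicit Defensive.

Import Order.TTheory GRing.Theory Num.Theory.

Local Open Scope classical_set_scope.
Local Open Scope ring_scope.

(* Ulam-Harris coding of the rooted tree in which every vertex has exactly
   [sigma] children: a vertex is the word of child labels read along the path
   from the root, so that the graph distance to the root is the word length. *)
Definition vertex (sigma : nat) : Type := seq 'I_sigma.

Definition root_vertex (sigma : nat) : vertex sigma := [::].

Definition height (sigma : nat) (v : vertex sigma) : nat := size v.

(* The edge [(v, i)] joins [v] to its [i]-th child [rcons v i]. *)
Definition edge (sigma : nat) : Type := (vertex sigma * 'I_sigma)%type.

Definition parent_end (sigma : nat) (e : edge sigma) : vertex sigma := e.1.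

Definition child_end (sigma : nat) (e : edge sigma) : vertex sigma :=
  rcons e.1 e.2.

Definition endpoints (sigma : nat) (e : edge sigma) : set (vertex sigma) :=
  [set parent_end e; child_end e].

Definition boundary (sigma : nat) (A : set (vertex sigma)) :
    set (edge sigma) :=
  [set e | (A (parent_end e) /\ ~ A (child_end e)) \/
           (~ A (parent_end e) /\ A (child_end e))].

Definition smallest_boundary_edge (R : realType) (sigma : nat)
    (w : edge sigma -> R) (A : set (vertex sigma)) (e : edge sigma) : Prop :=
  boundary A e /\ forall e', boundary A e' -> w e <= w e'.

(* When the weights are pairwise distinct (almost surely the case for i.i.d.
   uniform weights) exactly one edge satisfies [smallest_boundary_edge], since
   every [invasion w N] is finite; on the null event of ties all the minimal
   edges are adjoined at once. *)
Fixpoint invasion (R : realType) (sigma : nat) (w : edge sigma -> R)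
    (N : nat) : set (vertex sigma) :=
  if N is N'.+1 then
    invasion w N' `|`
    \bigcup_(e in smallest_boundary_edge w (invasion w N')) endpoints e
  else [set root_vertex sigma].

Definition invasion_cluster (R : realType) (sigma : nat)
    (w : edge sigma -> R) : set (vertex sigma) :=
  \bigcup_N invasion w N.

Definition up_to_height (sigma : nat) (A : set (vertex sigma)) (n : nat) :
    set (vertex sigma) :=
  A `&` [set v | (height v <= n)%N].

(* [fset_set] is only meaningful on finite sets. *)
Lemma finite_up_to_height (sigma : nat) (A : set (vertex sigma)) (n : nat) :
  finite_set (up_to_height A n).
Proof.
apply: (@sub_finite_set _ _
  (\bigcup_(k in `I_n.+1) range (fun t : k.-tuple 'I_sigma => tval t))).
  by move=> v [_ /= vn]; exists (size v) => //=; exists (in_tuple v).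
apply: bigcup_finite => [|k _]; first exact: finite_II.
exact/finite_image/finite_finset.
Qed.

Definition count_up_to_height (sigma : nat) (A : set (vertex sigma))
    (n : nat) : nat :=
  #|` fset_set (up_to_height A n)|%fset.

Definition mutually_independent (d : measure_display) (T : measurableType d)
    (R : realType) (P : probability T R) (E : choiceType)
    (X : E -> {RV P >-> R}) : Prop :=
  forall (J : {fset E}) (B : E -> set R),
    (forall e, measurable (B e)) ->
    P (\bigcap_(e in [set` J]) (X e @^-1` B e)) =
    (\prod_(e <- J) P (X e @^-1` B e))%E.

Definition iid_uniform01 (d : measure_display) (T : measurableType d)
    (R : realType) (P : probability T R) (E : choiceType)
    (X : E -> {RV P >-> R}) : Prop :=
  mutually_independent X /\
  forall (e : E) (B : set R), measurable B ->
    distribution P (X e) B = uniform_prob (@ltr01 R) B.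

(* Main.v *)
Require Import Defs.
From mathcomp Require Import all_boot all_order all_algebra finmap.
From mathcomp Require Import all_classical all_reals all_analysis.
From mathcomp Require Import measurable_realfun.
From mathcomp Require Import zify ring lra.

(* Round the weights to a fine grid. The tree of rounded weights up to a large
   depth is then uniformly distributed on a finite set, and all probabilities
   become averages over it. Let [Q(u)] be the minimax weight of the paths from
   [u] to the bottom level, and let the backbone follow at each vertex the child
   of least minimax weight. Without ties the backbone is invaded, and so is every
   cluster of edges of weight less than [1/sigma] that hangs off it, as long as
   [Q >= 1/sigma] along the backbone. Hence [z ^ C[0,n]] is at most the product
   over the backbone of [z ^ X], [X] being the sizes of these clusters truncated
   at a suitable depth.

   For [r = k/n] put [y = 1/sigma + r] and [z = 1 - r^2]. While [Q <= y], every
   backbone step costs a factor [1 - c r], because a critical cluster of depth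
   [1/r] has size of order [1/r^2] with probability of order [r] and this survives
   conditioning on [Q > y]. While [Q > y], each step moves [Q] below [y] with
   probability at least [c r], because the connection probability [reach] is
   Lipschitz in the critical window while [reach(y)] is of order [r]. Therefore
   [E z^(C[0,n])] decays exponentially in [k], and summing over [k] the events
   [C[0,n] <= n^2/k^2] bounds [E (n^2 / C[0,n])]. *)

Set Implicit Arguments.
Unset Strict Implicit.
Unset Printing Implicit Defensive.

Import Order.TTheory GRing.Theory Num.Theory.
Import numFieldNormedType.Exports.

Local Open Scope classical_set_scope.
Local Open Scope ring_scope.

(** * Connection probabilities *)

Section ReachProbability.
Variable R : realType.
Implicit Types p q r u x b : R.

Lemma bernoulli_sub n u : 0 <= u <= 1 -> 1 - n%:R * u <= (1 - u) ^+ n.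
Proof.
move=> /andP[u0 u1]; elim: n => [|n IH]; first by rewrite expr0 mul0r subr0.
rewrite exprS; apply: le_trans (ler_wpM2l _ IH); last by rewrite subr_ge0.
have n0 : 0 <= n%:R :> R by rewrite ler0n.
rewrite -natr1; nra.
Qed.

(** Second-order Taylor bound for [u ^+ n] at [b]: on [[0, 1]] the second derivative is at most
    [n ^ 2]. *)
Lemma expr_sub_le n b x : 0 <= x -> x <= b -> b <= 1 ->
  (b - x) ^+ n <= b ^+ n - n%:R * x * b ^+ n.-1 + n%:R ^+ 2 / 2 * x ^+ 2.
Proof.
move=> x0 xb b1; elim: n => [|[|n] IH].
- by rewrite !expr0 !mul0r !expr0n /= !mul0r subr0 addr0.
- by rewrite !expr1 expr0 /=; nra.
rewrite exprS; apply: le_trans (ler_wpM2l _ IH) _; first by rewrite subr_ge0.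
have bn1 : b ^+ n <= 1 by apply: exprn_ile1 => //; apply: le_trans xb.
have bn0 : 0 <= b ^+ n by apply: exprn_ge0; apply: le_trans xb.
rewrite /= !exprS !expr0 -[n.+2]addn2 -[n.+1]addn1 !natrD.
set k := n%:R; have k0 : 0 <= k by rewrite ler0n.
set t := b ^+ n in bn1 bn0 *.
rewrite -subr_ge0.
rewrite [X in 0 <= X](_ : _ =
  x ^+ 2 * ((k + 1) * (1 - t) + 1 / 2 + (1 - b + x) * ((k + 1) ^+ 2 / 2))); last by field.
apply: mulr_ge0; first exact: sqr_ge0.
have := sqr_ge0 (k + 1); set kk := (k + 1) ^+ 2 => kk0.
have : 0 <= (k + 1) * (1 - t) by nra.
have : 0 <= (1 - b + x) * (kk / 2) by apply: mulr_ge0; lra.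
lra.
Qed.

(** The quadratic surplus over Bernoulli's bound makes the critical connection probability decay
    like [1 / m]. *)
Lemma expr_sub_ge n u : (2 <= n)%N -> 0 <= u <= 1 ->
  1 - n%:R * u + u ^+ 2 <= (1 - u) ^+ n.
Proof.
move=> + /andP[u0 u1]; case: n => // -[//|n _]; elim: n => [|n IH].
  by rewrite !exprS expr0; nra.
rewrite exprS; apply: le_trans (ler_wpM2l _ IH); last by rewrite subr_ge0.
have n0 : 0 <= n%:R :> R by rewrite ler0n.
rewrite -natr1 -[in X in _ <= X]natr1 -natr1 -subr_ge0.
rewrite [X in 0 <= X](_ : _ = u ^+ 2 * (n%:R + 2 - u)); last by ring.
by apply: mulr_ge0; [exact: sqr_ge0|lra].
Qed.

(** [1 - (1 - u) ^ (n + 2)] is [u] times a geometric sum: its first [n + 1] terms are at least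
    [(1 - u) ^ n], and its last one is [(1 - u) ^ (n + 1)]. *)
Lemma one_sub_expr_ge n u : 0 <= u <= 1 ->
  u * (n.+1%:R * (1 - u) ^+ n + (1 - u) ^+ n.+1) <= 1 - (1 - u) ^+ n.+2.
Proof.
move=> /andP[u0 u1]; elim: n => [|n IH].
  by rewrite expr0 expr1 !exprS expr0; nra.
have t0 : 0 <= (1 - u) ^+ n by apply: exprn_ge0; lra.
have n0 : 0 <= n%:R :> R by rewrite ler0n.
move: IH; rewrite !(exprS _ n.+2) !(exprS _ n.+1) !(exprS _ n) -!natr1.
set t := (1 - u) ^+ n in t0 *; set k := n%:R in n0 *.
move=> IH; rewrite -subr_ge0.
rewrite [X in 0 <= X](_ : _ =
   (1 - (1 - u) * ((1 - u) * t) - u * ((k + 1) * t + (1 - u) * t)) +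
   (k + 1) * t * u ^+ 2); last by ring.
rewrite addr_ge0 ?subr_ge0// mulr_ge0 ?sqr_ge0// mulr_ge0//; lra.
Qed.

Lemma log_derivative_le s u : (2 <= s)%N -> 0 <= u <= 1 ->
  s%:R * u * (1 - u) ^+ s.-1 <= (1 - u / 2) * (1 - (1 - u) ^+ s).
Proof.
case: s => // -[//|n _] /andP[u0 u1].
have := one_sub_expr_ge n (introT andP (conj u0 u1)).
have t0 : 0 <= (1 - u) ^+ n by apply: exprn_ge0; lra.
have n0 : 0 <= n%:R :> R by rewrite ler0n.
rewrite /= => h; apply: le_trans (ler_wpM2l _ h); last lra.
move: t0; rewrite !exprS -!natr1.
set t := (1 - u) ^+ n; set k := n%:R in n0 * => t0.
rewrite -subr_ge0.
rewrite [X in 0 <= X](_ : _ = t * u * u * (k / 2 + u / 2)); last by field.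
by repeat apply: mulr_ge0 => //; lra.
Qed.

(* The probability that the root of the [s]-ary tree is connected to depth [m]
   by edges that are open independently with probability [p]. *)
Fixpoint reach s m p : R :=
  if m is m'.+1 then 1 - (1 - p * reach s m' p) ^+ s else 1.

Lemma reach_itv s m p : 0 <= p <= 1 -> 0 <= reach s m p <= 1.
Proof.
move=> /andP[p0 p1]; elim: m => [|m /andP[f0 f1]] /=; first by rewrite ler01 lexx.
have pf : 0 <= 1 - p * reach s m p <= 1 by apply/andP; split; nra.
case/andP: pf => h0 h1.
by rewrite subr_ge0 exprn_ile1//= lerBlDr lerDl exprn_ge0.
Qed.

Lemma reach_ge0 s m p : 0 <= p <= 1 -> 0 <= reach s m p.
Proof. by move=> /(reach_itv s m)/andP[]. Qed.

Lemma reach_le1 s m p : 0 <= p <= 1 -> reach s m p <= 1.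
Proof. by move=> /(reach_itv s m)/andP[]. Qed.

Lemma reach_gt0 s m p : (0 < s)%N -> 0 < p <= 1 -> 0 < reach s m p.
Proof.
move=> s0 /andP[p0 p1]; elim: m => [|m f0] /=; first exact: ltr01.
have f1 : reach s m p <= 1 by apply: reach_le1; rewrite ltW.
have pf0 : 0 < p * reach s m p by exact: mulr_gt0.
have pf1 : p * reach s m p <= 1 by rewrite -[leRHS]mulr1 ler_pM// ltW.
by rewrite subr_gt0 exprn_ilt1 -?lt0n//; lra.
Qed.

Lemma reach_step_homo s p a a' : 0 <= p <= 1 -> a <= a' -> a' <= 1 ->
  1 - (1 - p * a) ^+ s <= 1 - (1 - p * a') ^+ s.
Proof.
move=> /andP[p0 p1] aa a1; rewrite lerD2l lerN2; apply: lerXn2r.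
- by rewrite nnegrE; nra.
- by rewrite nnegrE; nra.
- by rewrite lerD2l lerN2 ler_wpM2l.
Qed.

Lemma reachS_le s m p : 0 <= p <= 1 -> reach s m.+1 p <= reach s m p.
Proof.
move=> p01; elim: m => [|m IH]; first exact: reach_le1.
by apply: reach_step_homo => //; exact: reach_le1.
Qed.

(** The value [a = r / s] is a subsolution of the recursion: the linear term is [(1 + r s) a], a
    gain of [(s a) ^ 2], and the quadratic loss is at most half of that. Monotonicity propagates the
    bound. *)
Lemma reach_ge s m r : (2 <= s)%N -> 0 <= r -> s%:R^-1 + r <= 1 ->
  r / s%:R <= reach s m (s%:R^-1 + r).
Proof.
move=> s2 r0 p1; set p := s%:R^-1 + r in p1 *.
have s0 : 0 < s%:R :> R by rewrite ltr0n ltnW.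
have s2R : 2 <= s%:R :> R by rewrite ler_nat.
have sV0 : 0 < s%:R^-1 :> R by rewrite invr_gt0.
have ps : p * s%:R = 1 + r * s%:R by rewrite mulrDl mulVf ?lt0r_neq0.
have p01 : 0 <= p <= 1 by apply/andP; split => //; rewrite /p; lra.
have a01 : 0 <= r / s%:R <= 1.
  by apply/andP; split; [exact/divr_ge0/ltW|rewrite ler_pdivrMr// mul1r; move: p1; rewrite /p; lra].
elim: m => [|m IH]; first by case/andP: a01.
apply: le_trans (reach_step_homo s p01 IH (reach_le1 _ _ p01)).
set a := r / s%:R in a01 *.
have ar : r = a * s%:R by rewrite /a divfK ?lt0r_neq0.
case/andP: a01 => a0 a1; case/andP: p01 => p0 _.
have := @expr_sub_le s 1 (p * a) (mulr_ge0 p0 a0) _ (lexx _).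
rewrite !expr1n mulr1 => /(_ _)/le_trans h.
rewrite -subr_ge0 addrAC subr_ge0.
apply: h; first by nra.
have -> : s%:R * (p * a) = (1 + r * s%:R) * a by rewrite -ps; ring.
have -> : s%:R ^+ 2 / 2 * (p * a) ^+ 2 = (s%:R * a) ^+ 2 * (p ^+ 2) / 2 by ring.
have : p ^+ 2 <= 1 by rewrite expr_le1.
rewrite ar; set S := s%:R * a; have -> : a * s%:R = S by rewrite mulrC.
have S0 : 0 <= S by rewrite mulr_ge0 // ltW.
have : (1 + S * s%:R) * a = a + S ^+ 2 by rewrite /S; ring.
move=> -> pp; have : S ^+ 2 * p ^+ 2 <= S ^+ 2 by rewrite ler_piMr ?sqr_ge0.
have := sqr_ge0 S; lra.
Qed.

(** At [p = 1 / s] a step maps [b] to at most [b (1 - b / s ^ 2)]. Either [b] is already below the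
    next bound, or this factor is less than [1 - 1 / (m + 2)], which turns [s ^ 2 / (m + 1)] into
    [s ^ 2 / (m + 2)]. *)
Lemma reach_critical_le s m : (2 <= s)%N ->
  reach s m s%:R^-1 <= s%:R ^+ 2 / m.+1%:R.
Proof.
move=> s2; set p : R := s%:R^-1.
have s0 : 0 < s%:R :> R by rewrite ltr0n ltnW.
have s2R : 2 <= s%:R :> R by rewrite ler_nat.
have p0 : 0 < p by rewrite invr_gt0.
have p1 : p <= 1 by rewrite invf_le1//; lra.
have p01 : 0 <= p <= 1 by rewrite ltW.
have ps : s%:R * p = 1 by rewrite mulfV// lt0r_neq0.
elim: m => [|m IH]; first by rewrite divr1/=; nra.
have b01 := reach_itv s m p01.
have dec := reachS_le s m p01.
move: b01 dec IH; rewrite [reach _ m.+1 _]/=; set b := reach s m p.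
move=> /andP[b0 b1] dec IH.
have m0 : 0 <= m%:R :> R by rewrite ler0n.
have [bs|bl] := leP b (s%:R ^+ 2 / m.+2%:R); first exact: le_trans bs.
have pb01 : 0 <= p * b <= 1 by apply/andP; split; nra.
have h := expr_sub_ge s2 pb01.
apply: (@le_trans _ _ (b * (1 - b * p ^+ 2))).
  rewrite mulrA ps in h; nra.
have pp : s%:R ^+ 2 * p ^+ 2 = 1 by rewrite -exprMn ps expr1n.
apply: (@le_trans _ _ (s%:R ^+ 2 / m.+1%:R * (1 - m.+2%:R^-1))).
  have m2 : 0 <= (m.+2%:R^-1 : R) by rewrite invr_ge0 ler0n.
  have bp : m.+2%:R^-1 <= b * p ^+ 2.
    apply: (@le_trans _ _ (s%:R ^+ 2 / m.+2%:R * p ^+ 2)).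
      by rewrite mulrAC pp mul1r.
    by rewrite ler_wpM2r ?sqr_ge0// ltW.
  have m21 : (m.+2%:R^-1 : R) <= 1 by rewrite invf_le1 ?ltr0n// ler1n.
  apply: (@le_trans _ _ (b * (1 - m.+2%:R^-1))).
    by rewrite ler_wpM2l// lerD2l lerN2.
  by rewrite ler_wpM2r// subr_ge0.
rewrite -!natr1 le_eqVlt; apply/orP; left; apply/eqP; field.
by rewrite !lt0r_neq0//; lra.
Qed.

Fixpoint dreach s m p : R :=
  if m is m'.+1
  then s%:R * (1 - p * reach s m' p) ^+ s.-1 * (reach s m' p + p * dreach s m' p)
  else 0.

Lemma is_derive_reach s m p : is_derive p 1 (reach s m) (dreach s m p).
Proof.
elim: m p => [|m IH] p; first exact: is_derive_cst.
have -> : reach s m.+1 = cst 1 - (cst 1 - id * reach s m) ^+ s.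
  by apply/funext => q; rewrite /= !fctE.
apply: is_derive_eq.
by rewrite !fctE /= !sub0r scalerN opprK /GRing.scale /= mulr1 (addrC (p * _)).
Qed.

(* The logarithmic derivative of [1 - (1 - u) ^ s] is at most [1 - u / 2], which
   keeps [p * dreach s m p] bounded uniformly in [m]. *)
Lemma dreach_le s m p : (2 <= s)%N -> s%:R^-1 <= p <= 1 ->
  0 <= dreach s m p /\ p * dreach s m p <= 2 * s%:R.
Proof.
move=> s2 /andP[sp p1].
have s0 : 0 < s%:R :> R by rewrite ltr0n ltnW.
have s2R : 2 <= s%:R :> R by rewrite ler_nat.
have p0 : 0 < p by apply: lt_le_trans sp; rewrite invr_gt0.
have ps : 1 <= p * s%:R by have := ler_wpM2r (ltW s0) sp; rewrite mulVf ?lt0r_neq0.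
have p01 : 0 <= p <= 1 by rewrite ltW.
elim: m => [|m [d0 dK]] /=; first by split => //; rewrite mulr0; lra.
have /andP[a0 a1] := reach_itv s m p01; have dec := reachS_le s m p01.
rewrite [reach _ m.+1 _]/= in dec.
set a := reach s m p in a0 a1 dec *; set D := dreach s m p in d0 dK *.
have pa0 : 0 <= p * a by nra.
have pa1 : p * a <= 1 by nra.
have x0 : 0 <= (1 - p * a) ^+ s.-1 by apply: exprn_ge0; lra.
have aD : 0 <= a + p * D by nra.
split; first by repeat apply: mulr_ge0 => //; exact: ltW.
have a_gt0 : 0 < a by apply: reach_gt0; [exact: ltnW|rewrite p0].
have := log_derivative_le s2 (introT andP (conj pa0 pa1)).
set X := (1 - p * a) ^+ s.-1 in x0 *; set Y := (1 - p * a) ^+ s in dec *.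
move=> h.
have {}h : s%:R * p * X <= 1 - p * a / 2.
  rewrite -(ler_pM2l a_gt0); apply: le_trans (_ : _ <= (1 - p * a / 2) * (1 - Y)) _.
    by apply: le_trans h; rewrite le_eqVlt; apply/orP; left; apply/eqP; ring.
  by rewrite mulrC; apply: ler_wpM2r => //; lra.
have -> : p * (s%:R * X * (a + p * D)) = s%:R * p * X * (a + p * D) by ring.
apply: le_trans (ler_wpM2r aD h) _.
(* In [(1 - p a / 2) (a + p D)] the bound [p D <= 2 s] leaves a deficit [p a s], which absorbs the
   new term [a] because [p s >= 1]. *)
have : 0 <= (1 - p * a / 2) * (2 * s%:R - p * D) by apply: mulr_ge0; lra.
have : a <= p * a * s%:R by nra.
nra.
Qed.

(** Mean value theorem; [x * dreach s m x <= 2 s] and [x >= 1 / s] make the constant independent of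
    the depth [m]. *)
Lemma reach_lipschitz s m p q : (2 <= s)%N -> s%:R^-1 <= p -> p <= q -> q <= 1 ->
  reach s m q - reach s m p <= 2 * s%:R ^+ 2 * (q - p).
Proof.
move=> s2 sp pq q1.
have s0 : 0 < s%:R :> R by rewrite ltr0n ltnW.
have cont : {within `[p, q], continuous (reach s m)}.
  apply: continuous_subspaceT => x.
  apply/differentiable_continuous/derivable1_diffP.
  by have [] := is_derive_reach s m x.
have [x] := MVT_segment pq (fun x _ => is_derive_reach s m x) cont.
rewrite in_itv /= => /andP[px xq] ->; apply: ler_wpM2r; first by rewrite subr_ge0.
have /= [] := @dreach_le s m x s2; first by rewrite (le_trans sp px) (le_trans xq q1).
move=> d0 dK; have sx : 1 <= s%:R * x.
  by have := ler_wpM2l (ltW s0) (le_trans sp px); rewrite mulfV ?lt0r_neq0.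
have : dreach s m x <= s%:R * (x * dreach s m x) by rewrite mulrA ler_peMl.
have : s%:R * (x * dreach s m x) <= s%:R * (2 * s%:R) by rewrite ler_wpM2l // ltW.
move=> h1 h2; apply: le_trans h2 _; apply: le_trans h1 _.
by rewrite expr2 mulrCA.
Qed.
End ReachProbability.

(* [t] stands for the expectation of [1 - z ^ Y] on the event that the root is not
   connected to the bottom level, where [z = 1 - r ^ 2] and [Y] is the size of the
   truncated critical cluster; the right-hand side is its value one level up. *)
Lemma truncated_cluster_step (R : realType) (s : nat) (A a r b t : R) :
  (2 <= s)%N -> 1 <= A -> 0 <= r -> r * (2 * s%:R * (A + 1)) <= 1 ->
  0 <= a <= A * r -> 0 <= b <= r / (2 * s%:R * A + 3) -> b <= t ->
  t / s%:R <= 1 - a ->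
  b + r ^+ 2 / (2 * s%:R * A + 3) <=
  (1 - a) ^+ s - (1 - r ^+ 2) * (1 - a - t / s%:R) ^+ s.
Proof.
move=> s2 A1 r0 rs /andP[a0 aA] /andP[b0 bE] bt t1.
have s0 : 0 < s%:R :> R by rewrite ltr0n ltnW.
have s2R : 2 <= s%:R :> R by rewrite ler_nat.
set e := (2 * s%:R * A + 3)^-1 in bE *.
have sA : 2 <= s%:R * A by nra.
have e0 : 0 < e by rewrite invr_gt0; nra.
have eE : e * (2 * s%:R * A + 3) = 1 by rewrite mulVf// lt0r_neq0//; nra.
have e1 : e <= 1 by nra.
have r1 : r <= 1 by nra.
have sr2 : 0 <= r ^+ 2 <= 1 by rewrite sqr_ge0 expr_le1.
set x := b / s%:R; have bx : s%:R * x = b by rewrite /x mulrC divfK// lt0r_neq0.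
have x0 : 0 <= x by rewrite divr_ge0// ltW.
have xt : x <= t / s%:R by rewrite ler_wpM2r// invr_ge0 ltW.
have sar : s%:R * a <= s%:R * A * r by rewrite -mulrA ler_wpM2l// ltW.
have br : b <= r by nra.
have sax : s%:R * (a + x) <= 1 / 2 by rewrite mulrDr bx; nra.
have a1 : a + x <= 1 by nra.
have ub : (1 - a - t / s%:R) ^+ s <= (1 - a - x) ^+ s.
  by apply: lerXn2r; rewrite ?nnegrE; lra.
have := expr_sub_le s x0 (le_trans xt t1); rewrite gerBl a0 => /(_ isT) mid.
have low : 1 / 2 <= (1 - a - x) ^+ s.
  have ax : 0 <= a + x <= 1 by rewrite a1 addr_ge0.
  have := bernoulli_sub s ax; rewrite opprD addrA; lra.
have ba : 1 - s%:R * A * r <= (1 - a) ^+ s.-1.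
  have a01 : 0 <= a <= 1 by rewrite a0; lra.
  apply: le_trans (bernoulli_sub s.-1 a01).
  have : s.-1%:R * a <= s%:R * a by rewrite ler_wpM2r// ler_nat leq_pred.
  lra.
have sx2 : s%:R ^+ 2 / 2 * x ^+ 2 = b ^+ 2 / 2 by rewrite -[in RHS]bx; field.
rewrite sx2 bx in mid.
set P := (1 - a - x) ^+ s in ub mid low; set S := (1 - a) ^+ s in mid *.
set U := (1 - a) ^+ s.-1 in ba mid; set V := (1 - a - t / s%:R) ^+ s in ub *.
(* Replacing [t] by its lower bound [b] leaves [b + r ^ 2 / 2] up to a first-order error of at most
   [e r ^ 2 s A] and a second-order error of at most [e r ^ 2 / 2]. As [e (s A + 3 / 2) = 1 / 2],
   exactly [b + e r ^ 2] remains. *)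
have h1 : (1 - r ^+ 2) * V <= (1 - r ^+ 2) * P by rewrite ler_wpM2l//; lra.
have h2 : b * (1 - s%:R * A * r) <= b * U by rewrite ler_wpM2l.
have h3 : r ^+ 2 / 2 <= r ^+ 2 * P by rewrite ler_wpM2l//; [lra|lra].
have h4 : b * (s%:R * A * r) <= e * r ^+ 2 * (s%:R * A).
  have -> : e * r ^+ 2 * (s%:R * A) = (r * e) * (s%:R * A * r) by ring.
  by rewrite ler_wpM2r//; nra.
have h5 : b ^+ 2 <= e * r ^+ 2.
  have -> : e * r ^+ 2 = (r * e) * r by ring.
  by rewrite expr2 ler_pM.
have h6 : e * r ^+ 2 * (2 * s%:R * A + 3) = r ^+ 2.
  by rewrite mulrAC eE mul1r.
lra.
Qed.

(** * Averages over finite types *)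

Section Average.
Variable R : realType.
Implicit Types T U I : finType.

Definition avg T (f : T -> R) : R := (\sum_t f t) / #|T|%:R.

Lemma avg_ge0 T (f : T -> R) : (forall t, 0 <= f t) -> 0 <= avg f.
Proof. by move=> f0; rewrite divr_ge0// sumr_ge0. Qed.

Lemma le_avg T (f g : T -> R) : (forall t, f t <= g t) -> avg f <= avg g.
Proof. by move=> fg; rewrite ler_wpM2r ?invr_ge0// ler_sum. Qed.

Lemma eq_avg T (f g : T -> R) : f =1 g -> avg f = avg g.
Proof. by move=> fg; congr (_ / _); apply: eq_bigr => t _; rewrite fg. Qed.

Lemma avgD T (f g : T -> R) : avg (fun t => f t + g t) = avg f + avg g.
Proof. by rewrite /avg big_split mulrDl. Qed.

Lemma avgB T (f g : T -> R) : avg (fun t => f t - g t) = avg f - avg g.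
Proof. by rewrite /avg big_split sumrN mulrDl mulNr. Qed.

Lemma avgZl T (k : R) (f : T -> R) : avg (fun t => k * f t) = k * avg f.
Proof. by rewrite /avg -mulr_sumr mulrA. Qed.

Lemma avgZr T (k : R) (f : T -> R) : avg (fun t => f t * k) = avg f * k.
Proof. by rewrite mulrC -avgZl; apply: eq_avg => t; rewrite mulrC. Qed.

Lemma avg_cst T (k : R) : (0 < #|T|)%N -> avg (fun _ : T => k) = k.
Proof.
by move=> T0; rewrite /avg sumr_const -(mulr_natr k) mulfK// pnatr_eq0 -lt0n.
Qed.

Lemma avg_sum T I (P : pred I) (F : I -> T -> R) :
  avg (fun t => \sum_(i | P i) F i t) = \sum_(i | P i) avg (F i).
Proof. by rewrite /avg exchange_big mulr_suml. Qed.

Lemma avg_pair T U (f : T * U -> R) :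
  avg f = avg (fun t => avg (fun u => f (t, u))).
Proof.
rewrite /avg -mulr_suml -mulrA card_prod natrM invfM (mulrC #|T|%:R^-1).
by congr (_ * _); rewrite pair_bigA; apply: eq_bigr => -[].
Qed.

Lemma avg_pairM T U (f : T -> R) (g : U -> R) :
  avg (fun p : T * U => f p.1 * g p.2) = avg f * avg g.
Proof.
by rewrite avg_pair -avgZr; apply: eq_avg => t /=; rewrite avgZl.
Qed.

Lemma avg_fst T U (f : T -> R) : (0 < #|U|)%N ->
  avg (fun p : T * U => f p.1) = avg f.
Proof. by move=> U0; rewrite avg_pair; apply: eq_avg => t; rewrite /= avg_cst. Qed.

Lemma avg_snd T U (f : U -> R) : (0 < #|T|)%N ->
  avg (fun p : T * U => f p.2) = avg f.
Proof. by move=> T0; rewrite avg_pair /= avg_cst. Qed.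

Lemma avg_partition T n (k : T -> nat) (f : T -> R) : (forall t, k t < n)%N ->
  avg f = \sum_(q < n) avg (fun t => (k t == q)%:R * f t).
Proof.
move=> kn; rewrite -avg_sum; apply: eq_avg => t.
rewrite (bigD1 (Ordinal (kn t)))//= eqxx mul1r big1 ?addr0// => q.
by rewrite -val_eqE eq_sym /= => /negPf ->; rewrite mul0r.
Qed.

Lemma exists_le_sum I (b : pred I) :
  ([exists i, b i])%:R <= \sum_i (b i)%:R :> R.
Proof.
case: existsP => [[i bi]|_]; last by rewrite sumr_ge0.
by rewrite (bigD1 i)//= bi lerDl sumr_ge0.
Qed.

Lemma avg_prod I T (F : I -> T -> R) :
  avg (fun t : {ffun I -> T} => \prod_i F i (t i)) = \prod_i avg (F i).
Proof.
rewrite /avg -bigA_distr_bigA prodf_div; congr (_ / _).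
by rewrite prodr_const card_ffun natrX.
Qed.

Lemma avg_coord I T (i : I) (f : T -> R) : (0 < #|T|)%N ->
  avg (fun t : {ffun I -> T} => f (t i)) = avg f.
Proof.
move=> T0; pose F j := if j == i then f else fun=> 1.
transitivity (avg (fun t : {ffun I -> T} => \prod_j F j (t j))).
  apply: eq_avg => t; rewrite (bigD1 i)//= {1}/F eqxx big1 ?mulr1//.
  by move=> j /negPf ji; rewrite /F ji.
rewrite avg_prod (bigD1 i)//= {1}/F eqxx big1 ?mulr1//.
by move=> j /negPf ji; rewrite /F ji avg_cst.
Qed.

Lemma avg_coord_others I T (i : I) (f g : T -> R) :
  avg (fun t : {ffun I -> T} => f (t i) * \prod_(j | j != i) g (t j)) =
  avg f * avg g ^+ #|I|.-1.
Proof.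
pose F j := if j == i then f else g.
have Fi : F i = f by rewrite /F eqxx.
have Fj j : j != i -> F j = g by move=> /negPf ji; rewrite /F ji.
transitivity (avg (fun t : {ffun I -> T} => \prod_j F j (t j))).
  apply: eq_avg => t; rewrite [RHS](bigD1 i)//= Fi; congr (_ * _).
  by apply: eq_bigr => j /Fj ->.
rewrite avg_prod (bigD1 i)//= Fi; congr (_ * _).
rewrite (eq_bigr (fun=> avg g)) => [|j /Fj -> //].
by rewrite prodr_const -(cardC1 i).
Qed.

Lemma avg_coord2 I T (i j : I) (f g : T -> R) : (0 < #|T|)%N -> i != j ->
  avg (fun t : {ffun I -> T} => f (t i) * g (t j)) = avg f * avg g.
Proof.
move=> T0 ij; pose F k := if k == i then f else if k == j then g else fun=> 1.
have Fj : F j = g by rewrite /F eq_sym (negPf ij) eqxx.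
have Fk k : (k != i) && (k != j) -> F k = fun=> 1.
  by move=> /andP[/negPf ki /negPf kj]; rewrite /F ki kj.
transitivity (avg (fun t : {ffun I -> T} => \prod_k F k (t k))).
  apply: eq_avg => t; rewrite (bigD1 i)//= (bigD1 j)/=; last by rewrite eq_sym.
  by rewrite Fj {1}/F eqxx big1 ?mulr1// => k /Fk ->.
rewrite avg_prod (bigD1 i)//= (bigD1 j)/=; last by rewrite eq_sym.
by rewrite Fj {1}/F eqxx big1 ?mulr1// => k /Fk ->; rewrite avg_cst.
Qed.

Lemma avg_ord_lt N k : (k <= N)%N ->
  avg (fun a : 'I_N => (a < k)%N%:R) = k%:R / N%:R.
Proof.
move=> kN; rewrite /avg card_ord; congr (_ / _).
rewrite -(big_mkord xpredT (fun a => (a < k)%N%:R)) (big_cat_nat _ kN)//=.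
rewrite [X in _ + X]big_nat_cond [X in _ + X]big1 ?addr0; last first.
  by move=> a /andP[/andP[ka _] _]; rewrite ltnNge ka.
rewrite big_nat_cond (eq_bigr (fun=> 1)); last by move=> a /andP[/andP[_ ->] _].
by rewrite -big_nat_cond sumr_const_nat subn0.
Qed.

Lemma avg_ord_eq_le N q : avg (fun a : 'I_N => (a == q :> nat)%:R) <= N%:R^-1.
Proof.
rewrite /avg card_ord -[leRHS]mul1r ler_wpM2r ?invr_ge0//.
have [qN|Nq] := ltnP q N.
  rewrite (bigD1 (Ordinal qN))//= eqxx big1 ?addr0// => a.
  by rewrite -val_eqE /= => /negPf ->.
by rewrite big1// => a _; rewrite ltn_eqF// (leq_trans (ltn_ord a)).
Qed.
End Average.

(** * Finite weighted trees *)

Lemma bigminn_le (I : finType) (F : I -> nat) (n : nat) (i : I) :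
  (\big[minn/n]_j F j <= F i)%N.
Proof.
have : i \in index_enum I by exact: mem_index_enum.
elim: (index_enum I) => // j r IH; rewrite big_cons inE => /predU1P[<-|/IH ir].
  exact: geq_minl.
by rewrite geq_min ir orbT.
Qed.

Section WeightedTree.
Variables s N : nat.

(** Each child is stored with the index of the edge leading to it, so the uniform law on this finite
    type makes all edge indices independent and uniform on ['I_N]. *)
Fixpoint wtree (m : nat) : finType :=
  if m is m'.+1 then {ffun 'I_s -> 'I_N * wtree m'} else unit.

Definition wbranch (m : nat) : finType := ('I_N * wtree m)%type.

(** Least, over the paths to the bottom level, of the largest edge index on the path. The empty
    minimum [N] exceeds every index. *)
Fixpoint minimax (m : nat) : wtree m -> nat :=
  if m is m'.+1 return wtree m -> nat
  then fun t => \big[minn/N]_(i < s) maxn (t i).1 (minimax (t i).2)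
  else fun=> 0%N.

Definition branch_minimax m (p : wbranch m) : nat := maxn p.1 (minimax p.2).

Lemma minimaxS m (t : wtree m.+1) :
  minimax t = \big[minn/N]_(i < s) branch_minimax (t i).
Proof. by []. Qed.

Lemma minimax_le m (t : wtree m) : (minimax t <= N)%N.
Proof.
case: m t => [//|m] t; rewrite minimaxS.
by elim/big_rec: _ => // i x _ xN; rewrite geq_min xN orbT.
Qed.

Lemma minimax_lt m (t : wtree m.+1) k : (k <= N)%N ->
  (minimax t < k)%N = [exists i, branch_minimax (t i) < k]%N.
Proof.
move=> kN; rewrite minimaxS; apply/idP/existsP => [|[i ik]]; last first.
  exact: leq_ltn_trans (bigminn_le _ _ i) ik.
elim/big_rec: _ => [|i x _ IH]; first by rewrite ltnNge kN.
by rewrite gtn_min => /orP[ik|/IH//]; exists i.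
Qed.

Lemma minimax_le_branch m (t : wtree m.+1) i :
  (minimax t <= branch_minimax (t i))%N.
Proof. by rewrite minimaxS; exact: (bigminn_le (fun i => branch_minimax (t i))). Qed.

Lemma branch_minimax_le m (p : wbranch m) : (branch_minimax p <= N)%N.
Proof. by rewrite geq_max minimax_le ltnW. Qed.

Lemma minimax_strict m (t : wtree m.+1) i :
  (forall j, j != i -> branch_minimax (t i) < branch_minimax (t j))%N ->
  minimax t = branch_minimax (t i).
Proof.
move=> imin; apply/eqP; rewrite eqn_leq minimax_le_branch andTb minimaxS.
elim/big_rec: _ => [|j x _ ix]; first exact: branch_minimax_le.
rewrite leq_min ix andbT.
by have [->//|/imin/ltnW] := eqVneq j i.
Qed.

Fixpoint cluster (c m h : nat) : wtree m -> seq (seq 'I_s) :=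
  match m, h return wtree m -> seq (seq 'I_s) with
  | m'.+1, h'.+1 => fun t => [::] ::
      flatten [seq if ((t i).1 < c)%N then map (cons i) (cluster c h' (t i).2)
               else [::] | i <- enum 'I_s]
  | _, _ => fun=> [:: [::]]
  end.

Definition branch_cluster (c m h : nat) (i : 'I_s) (p : wbranch m) :
    seq (seq 'I_s) :=
  if (p.1 < c)%N then map (cons i) (cluster c h p.2) else [::].

Definition branch_size (c m h : nat) (p : wbranch m) : nat :=
  if (p.1 < c)%N then size (cluster c h p.2) else 0.

Lemma size_branch_cluster c m h i (p : wbranch m) :
  size (branch_cluster c h i p) = branch_size c h p.
Proof. by rewrite /branch_cluster /branch_size; case: ifP; rewrite ?size_map. Qed.

Lemma size_clusterS c m h (t : wtree m.+1) :
  size (cluster c h.+1 t) = (\sum_i branch_size c h (t i)).+1.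
Proof.
rewrite /= size_flatten sumnE 2!big_map big_enum /=; congr _.+1.
by apply: eq_bigr => i _; exact: size_branch_cluster.
Qed.

(* A tie between siblings prevents the invasion backbone from being read off
   the discretised weights. *)
Fixpoint tie (m : nat) : wtree m -> bool :=
  if m is m'.+1 return wtree m -> bool then fun t =>
    [exists i, exists j, (i != j) &&
       (branch_minimax (t i) == branch_minimax (t j))] ||
    [exists i, tie (t i).2]
  else fun=> false.

(** For [k <= m]: some vertex of level [k] is joined to the bottom level by edges of index below
    [c]. A shallower vertex so joined forces one at level [k], so testing this level covers the
    whole initial part of the backbone. *)
Fixpoint low_vertex (c m k : nat) : wtree m -> bool :=
  match m, k return wtree m -> bool with
  | m'.+1, k'.+1 => fun t => [exists i, low_vertex c k' (t i).2]
  | _, _ => fun t => (minimax t < c)%N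
  end.

Variable R : realType.

(* [z ^+ D] summed over the strict backbones of length [k], at most one of
   which exists; [D] is the total size of the [c]-clusters that hang off the
   backbone. *)
Fixpoint backbone_weight (z : R) (c h m k : nat) : wtree m -> R :=
  match m, k return wtree m -> R with
  | m'.+1, k'.+1 => fun t =>
      \sum_i backbone_weight z c h k' (t i).2 *
        \prod_(j | j != i) ((branch_minimax (t i) < branch_minimax (t j))%N%:R *
                            z ^+ branch_size c h (t j))
  | _, _ => fun=> 1
  end.

Hypothesis s_gt0 : (0 < s)%N.
Hypothesis N_gt0 : (0 < N)%N.

Lemma card_wtree_gt0 m : (0 < #|wtree m|)%N.
Proof.
elim: m => [|m IH]; first by rewrite card_unit.
by rewrite card_ffun expn_gt0 card_prod card_ord muln_gt0 N_gt0 IH.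
Qed.

Lemma card_wbranch_gt0 m : (0 < #|wbranch m|)%N.
Proof. by rewrite card_prod card_ord muln_gt0 N_gt0 card_wtree_gt0. Qed.

Lemma card_ordN_gt0 : (0 < #|'I_N|)%N.
Proof. by rewrite card_ord. Qed.

Lemma avg_compl (T : finType) (b : pred T) : (0 < #|T|)%N ->
  avg (fun t => (~~ b t)%:R : R) = 1 - avg (fun t => (b t)%:R).
Proof.
move=> T0; transitivity (avg (fun t => 1 - (b t)%:R : R)).
  by apply: eq_avg => t; case: (b t); rewrite /= ?subrr ?subr0.
by rewrite avgB avg_cst.
Qed.

(** Call the edges of index below [k] open: they are independent with probability [k / N], and
    [minimax t < k] says that the root is connected to the bottom level. *)
Lemma avg_minimax_lt m k : (0 < k <= N)%N ->
  avg (fun t : wtree m => (minimax t < k)%N%:R : R) = reach s m (k%:R / N%:R).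
Proof.
move=> /andP[k0 kN]; elim: m => [|m IH].
  rewrite (eq_avg (g := fun=> 1)) ?avg_cst ?card_wtree_gt0//.
  by move=> t /=; rewrite k0.
transitivity (1 - avg (fun t : wtree m.+1 =>
    \prod_i (~~ (branch_minimax (t i) < k)%N)%:R : R)).
  transitivity (avg (fun t : wtree m.+1 =>
      1 - \prod_i (~~ (branch_minimax (t i) < k)%N)%:R : R)); last first.
    by rewrite avgB avg_cst// card_wtree_gt0.
  apply: eq_avg => t; rewrite minimax_lt//.
  case: existsP => [[i ik]|nk]; first by rewrite (bigD1 i)//= ik mul0r subr0.
  rewrite big1 ?subrr// => i _; case: ltnP => // ik.
  by case: nk; exists i.
rewrite (avg_prod (fun _ (p : wbranch m) => (~~ (branch_minimax p < k)%N)%:R)).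
rewrite prodr_const card_ord /= avg_compl ?card_wbranch_gt0//; congr (1 - (1 - _) ^+ _).
rewrite -IH -(avg_ord_lt _ kN) -avg_pairM; apply: eq_avg => p.
by rewrite gtn_max -mulnb natrM.
Qed.

Lemma avg_branch_minimax_lt m k : (0 < k <= N)%N ->
  avg (fun p : wbranch m => (branch_minimax p < k)%N%:R : R) =
  k%:R / N%:R * reach s m (k%:R / N%:R).
Proof.
move=> kN; rewrite -avg_minimax_lt//; case/andP: kN => _ kN.
rewrite -(avg_ord_lt _ kN) -avg_pairM; apply: eq_avg => p.
by rewrite gtn_max -mulnb natrM.
Qed.
End WeightedTree.

(** * Probabilities of ties and of low vertices *)

Section BadEvents.
Variables (R : realType) (s N : nat).
Hypothesis s_gt0 : (0 < s)%N.
Hypothesis N_gt0 : (0 < N)%N.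

Let wt := wtree s N.
Let wb := wbranch s N.

Lemma avg_root_weight m (f : 'I_N -> R) : avg (fun p : wb m => f p.1) = avg f.
Proof. by rewrite [LHS](avg_fst f (card_wtree_gt0 s N_gt0 m)). Qed.

Lemma avg_subtree m (f : wt m -> R) : avg (fun p : wb m => f p.2) = avg f.
Proof. by rewrite [LHS](avg_snd f (card_ordN_gt0 N_gt0)). Qed.

Lemma sum_ord_le (F : 'I_s -> R) (C : R) :
  (forall i, F i <= C) -> \sum_i F i <= s%:R * C.
Proof.
by move=> FC; rewrite mulr_natl -[X in _ *+ X]card_ord -sumr_const ler_sum.
Qed.

Lemma minimax_ltN m (t : wt m) : (minimax t < N)%N.
Proof.
elim: m t => [//|m IH] t; rewrite minimax_lt//; apply/existsP.
by exists (Ordinal s_gt0); rewrite gtn_max ltn_ord IH.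
Qed.

Lemma minimax_attained m (t : wt m.+1) :
  exists i, minimax t = branch_minimax (t i).
Proof.
have := ltnSn (minimax t); rewrite minimax_lt ?minimax_ltN// => /existsP[i].
rewrite ltnS => it; exists i; apply/eqP.
by rewrite eqn_leq it minimax_le_branch.
Qed.

(** The minimax value is the index of some edge of the branch. There are at most [(m + 1) s ^ m]
    edges, and each has index [q] with probability at most [1 / N]. *)
Lemma avg_branch_minimax_eq_le m (q : nat) :
  avg (fun p : wb m => (branch_minimax p == q)%:R : R) <=
  m.+1%:R * s%:R ^+ m / N%:R.
Proof.
have s1 : 1 <= s%:R :> R by rewrite ler1n.
elim: m => [|m IH].
  rewrite expr0 mulr1 mul1r; apply: le_trans (avg_ord_eq_le R N q).
  rewrite le_eqVlt -(@avg_root_weight 0).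
  by apply/orP; left; apply/eqP/eq_avg => -[a []]; rewrite /branch_minimax /= maxn0.
apply: (@le_trans _ _ (avg (fun p : wb m.+1 =>
    (p.1 == q :> nat)%:R + \sum_i (branch_minimax (p.2 i) == q)%:R : R))).
  apply: le_avg => -[a t]; rewrite -[branch_minimax (a, t)]/(maxn a (minimax t)).
  rewrite -[(a, t).1]/a -[(a, t).2]/t; case: leqP => _.
    apply: (@le_trans _ _ (\sum_i (branch_minimax (t i) == q)%:R)); last by rewrite lerDr.
    have [i ->] := minimax_attained t.
    by rewrite (bigD1 i)//= lerDl sumr_ge0.
  by rewrite lerDl sumr_ge0.
rewrite avgD (avg_root_weight _ (fun a : 'I_N => (a == q :> nat)%:R)).
rewrite (avg_subtree (fun t : wt m.+1 => \sum_i (branch_minimax (t i) == q)%:R)).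
rewrite avg_sum.
under eq_bigr do rewrite (avg_coord _ (fun p : wb m => (branch_minimax p == q)%:R))
  ?card_wbranch_gt0//.
rewrite sumr_const card_ord -[X in _ + X <= _]mulr_natl.
apply: le_trans (lerD (avg_ord_eq_le _ _ _) (ler_wpM2l (ler0n R s) IH)) _.
rewrite mulrA -[X in X + _]mul1r -mulrDl ler_wpM2r ?invr_ge0//.
rewrite mulrCA -exprS -[m.+2%:R]nat1r mulrDl mul1r lerD2r.
by rewrite exprn_ege1.
Qed.

(** Sibling branches are independent: partition by the value of one and apply the bound on a single
    value to the other. *)
Lemma avg_branch_tie_le m (i j : 'I_s) : i != j ->
  avg (fun t : wt m.+1 => (branch_minimax (t i) == branch_minimax (t j))%:R : R)
  <= m.+1%:R * s%:R ^+ m / N%:R.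
Proof.
move=> ij; pose e q (p : wb m) : R := (branch_minimax p == q)%:R.
set C := leRHS.
have bN (p : wb m) : (branch_minimax p < N.+1)%N by rewrite ltnS branch_minimax_le.
rewrite (avg_partition _ (fun t : wt m.+1 => bN (t i))).
apply: (@le_trans _ _ (\sum_(q < N.+1) avg (e q) * C)).
  apply: ler_sum => q _.
  rewrite (eq_avg (g := fun t : wt m.+1 => e q (t i) * e q (t j))); last first.
    by move=> t; rewrite /e; case: eqP => [->|_]; rewrite ?mul0r ?mul1r 1?eq_sym.
  rewrite avg_coord2 ?card_wbranch_gt0// ler_wpM2l ?avg_ge0//.
  exact: avg_branch_minimax_eq_le.
rewrite -mulr_suml -[leRHS]mul1r ler_wpM2r//.
  by rewrite divr_ge0// mulr_ge0// exprn_ge0.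
rewrite -[leRHS](avg_cst (1 : R) (card_wbranch_gt0 s N_gt0 m)) [leRHS](avg_partition _ bN).
by apply: ler_sum => q _; apply: le_avg => p; rewrite mulr1.
Qed.

(** Union bound over the pairs of siblings; the induction closes by
    [m + 1 + m ^ 2 <= (m + 1) ^ 2]. *)
Lemma avg_tie_le m :
  avg (fun t : wt m => (tie t)%:R : R) <= (m ^ 2)%:R * s%:R ^+ m.+1 / N%:R.
Proof.
elim: m => [|m IH]; first by rewrite !mul0r /avg big1 ?mul0r.
apply: (@le_trans _ _ (avg (fun t : wt m.+1 =>
   (\sum_i \sum_(j | i != j)
      (branch_minimax (t i) == branch_minimax (t j))%:R) +
   \sum_i (tie (t i).2)%:R : R))).
  apply: le_avg => t /=.
  apply: (@le_trans _ _ ([exists i, exists j, (i != j) &&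
      (branch_minimax (t i) == branch_minimax (t j))]%:R +
      [exists i, tie (t i).2]%:R)).
    by rewrite -natrD ler_nat; case: [exists i, _]; case: [exists i, _].
  apply: lerD; last exact: exists_le_sum.
  apply: le_trans (exists_le_sum _ _) _; apply: ler_sum => i _.
  apply: le_trans (exists_le_sum _ _) _; rewrite [leRHS]big_mkcond.
  by apply: ler_sum => j _; case: (i != j).
rewrite avgD !avg_sum.
under [X in _ + X]eq_bigr do rewrite
  (avg_coord _ (fun p : wb m => (tie p.2)%:R)) ?card_wbranch_gt0//
  (avg_subtree (fun t : wt m => (tie t)%:R)).
rewrite sumr_const card_ord -[X in _ + X <= _]mulr_natl.
under eq_bigr do rewrite avg_sum.
have le1 : \sum_i \sum_(j | i != j) avg (fun t : wt m.+1 =>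
    (branch_minimax (t i) == branch_minimax (t j))%:R : R) <=
    s%:R * (s%:R * (m.+1%:R * s%:R ^+ m / N%:R)).
  apply: sum_ord_le => i; rewrite [leLHS]big_mkcond; apply: sum_ord_le => j.
  case: ifP => [ij|_]; first exact: avg_branch_tie_le.
  by rewrite divr_ge0// mulr_ge0// exprn_ge0.
apply: le_trans (lerD le1 (ler_wpM2l (ler0n _ _) IH)) _.
rewrite (_ : _ + _ = (m.+1 + m ^ 2)%:R * s%:R ^+ m.+2 / N%:R); last first.
  by rewrite natrD !exprS; ring.
rewrite !ler_wpM2r ?invr_ge0 ?exprn_ge0// ler_nat; lia.
Qed.

(** Union bound over the [s ^ k] vertices of level [k], each the root of a uniform tree of depth
    [m - k]. *)
Lemma avg_low_vertex_le c m k : (k <= m)%N -> (0 < c <= N)%N ->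
  avg (fun t : wt m => (low_vertex c k t)%:R : R) <=
  s%:R ^+ k * reach s (m - k) (c%:R / N%:R).
Proof.
move=> + cN; elim: k m => [|k IH] m.
  rewrite subn0 mul1r => _; case: m => [|m]; rewrite -avg_minimax_lt//.
case: m => // m; rewrite ltnS subSS => km.
apply: (@le_trans _ _ (avg (fun t : wt m.+1 =>
    \sum_i (low_vertex c k (t i).2)%:R : R))).
  by apply: le_avg => t; exact: exists_le_sum.
rewrite avg_sum.
under eq_bigr do rewrite
  (avg_coord _ (fun p : wb m => (low_vertex c k p.2)%:R)) ?card_wbranch_gt0//
  (avg_subtree (fun t : wt m => (low_vertex c k t)%:R)).
by rewrite sumr_const card_ord -[leLHS]mulr_natl exprS -mulrA ler_wpM2l// IH.
Qed.
End BadEvents.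

(** * Recursion along the backbone *)

Section BackboneRecursion.
Variables (R : realType) (s N : nat).
Hypothesis s_gt1 : (1 < s)%N.
Hypothesis N_gt0 : (0 < N)%N.
Variables (z : R) (c h : nat).
Hypothesis z01 : 0 <= z <= 1.

Let s_gt0 : (0 < s)%N. Proof. exact: ltnW. Qed.
Let wt := wtree s N.
Let wb := wbranch s N.
Let phi m k : wt m -> R := backbone_weight z c h k.

Let zX_ge0 n : 0 <= z ^+ n. Proof. by case/andP: z01 => z0 _; exact: exprn_ge0. Qed.
Let zX_le1 n : z ^+ n <= 1. Proof. by case/andP: z01 => z0 z1; exact: exprn_ile1. Qed.

Lemma backbone_weight_ge0 m k (t : wt m) : 0 <= phi k t.
Proof.
elim: m k t => [|m IH] [|k] t //=; apply: sumr_ge0 => i _.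
by apply: mulr_ge0; [exact: IH|apply: prodr_ge0 => j _; exact: mulr_ge0].
Qed.

Let level_mass m (q : nat) : R := avg (fun t : wt m => (minimax t == q)%:R).
Let branch_mass m (q : nat) : R :=
  avg (fun p : wb m => (branch_minimax p == q)%:R).
Let branch_tail m (q : nat) : R :=
  avg (fun p : wb m => (q < branch_minimax p)%N%:R).
Let branch_tail_weight m (q : nat) : R :=
  avg (fun p : wb m => (q < branch_minimax p)%N%:R * z ^+ branch_size c h p).

(** The [s] choices of the backbone child contribute equally. Once its level [q] is fixed, the other
    [s - 1] branches are independent of it and only have to lie above [q]. *)
Lemma avg_backbone_weightS m k q :
  avg (fun t : wt m.+1 => (minimax t == q)%:R * phi k.+1 t) =
  s%:R * (avg (fun p : wb m => (branch_minimax p == q)%:R * phi k p.2) *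
          branch_tail_weight m q ^+ s.-1).
Proof.
pose f (p : wb m) := (branch_minimax p == q)%:R * phi k p.2.
pose g (p : wb m) := (q < branch_minimax p)%N%:R * z ^+ branch_size c h p.
transitivity (avg (fun t : wt m.+1 =>
    \sum_i f (t i) * \prod_(j | j != i) g (t j))); last first.
  rewrite avg_sum; under eq_bigr do rewrite avg_coord_others.
  by rewrite sumr_const card_ord -[LHS]mulr_natl.
apply: eq_avg => t; rewrite [phi _ _]/= mulr_sumr; apply: eq_bigr => i _.
rewrite mulrA /f.
have [strict|] := boolP [forall (j | j != i),
    branch_minimax (t i) < branch_minimax (t j)]%N.
  have -> : minimax t = branch_minimax (t i).
    by apply: minimax_strict => j ji; move/forall_inP: strict; exact.
  by rewrite /g; case: eqP => [<-|_] //; rewrite !mul0r.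
rewrite negb_forall_in => /exists_inP[j ji]; rewrite -leqNgt => jlei.
rewrite [in LHS](bigD1 j)//= ltnNge jlei !mul0r mulr0.
case: eqP => [iq|_]; last by rewrite !mul0r.
by rewrite (bigD1 j)//= /g -iq ltnNge jlei !mul0r mulr0.
Qed.

(** The events that a given child is the strict minimiser at level [q] are disjoint; ties account
    for the inequality. *)
Lemma level_massS_ge m q :
  s%:R * (branch_mass m q * branch_tail m q ^+ s.-1) <= level_mass m.+1 q.
Proof.
pose f (p : wb m) : R := (branch_minimax p == q)%:R.
pose g (p : wb m) : R := (q < branch_minimax p)%N%:R.
apply: (@le_trans _ _ (avg (fun t : wt m.+1 =>
    \sum_i f (t i) * \prod_(j | j != i) g (t j)))).
  rewrite avg_sum; under eq_bigr do rewrite avg_coord_others.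
  by rewrite sumr_const card_ord -[leRHS]mulr_natl.
apply: le_avg => t.
have zero i : ~~ ((branch_minimax (t i) == q) &&
    [forall (j | j != i), q < branch_minimax (t j)]%N) ->
    f (t i) * \prod_(j | j != i) g (t j) = 0.
  rewrite negb_and /f => /orP[/negPf ->|]; first by rewrite mul0r.
  rewrite negb_forall_in => /exists_inP[j ji]; rewrite -leqNgt => jq.
  by rewrite (bigD1 j)//= /g ltnNge jq !mul0r mulr0.
have [/existsP[i /andP[/eqP iq /forall_inP istrict]]|none] := boolP
  [exists i, (branch_minimax (t i) == q) &&
    [forall (j | j != i), q < branch_minimax (t j)]%N]; last first.
  rewrite big1// => i _; apply: zero; apply: contra none => h'.
  by apply/existsP; exists i.
rewrite (_ : \sum_i _ = f (t i) * \prod_(j | j != i) g (t j)); last first.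
  rewrite (bigD1 i)//= [X in _ + X]big1 ?addr0// => j ji; apply: zero.
  by rewrite gtn_eqF// istrict.
rewrite (minimax_strict (i := i)) ?iq// /f iq eqxx mul1r.
by apply: prodr_ile1 => j _; rewrite /g; case: ltnP => _; rewrite /= ?lexx ?ler01.
Qed.

(** Here [p q] bounds the conditional mean of [f] given the minimax value [q]; averaging over [q]
    against a weight [g >= 0] preserves the bound. *)
Lemma avg_le_levels m (f : wt m -> R) (g p : nat -> R) :
  (forall q, 0 <= g q) ->
  (forall q, avg (fun t => (minimax t == q)%:R * f t) <= p q * level_mass m q) ->
  avg (fun t => g (minimax t) * f t) <=
  avg (fun t : wt m => g (minimax t) * p (minimax t)).
Proof.
move=> g0 fp; have QN (t : wt m) : (minimax t < N.+1)%N.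
  by rewrite ltnS minimax_le.
rewrite !(avg_partition _ QN); apply: ler_sum => q _.
rewrite (eq_avg (g := fun t => g q * ((minimax t == q)%:R * f t))); last first.
  by move=> t; case: eqP => [->|_]; rewrite ?mul0r ?mulr0// !mul1r.
rewrite [leRHS](eq_avg (g := fun t => g q * (p q * (minimax t == q)%:R))).
  by rewrite !avgZl ler_wpM2l.
by move=> t; case: eqP => [->|_]; rewrite ?mul0r ?mulr0// !mulr1 mul1r.
Qed.

Variables (y m0 : nat) (kap : R).
Hypothesis kap01 : 0 <= kap <= 1.
Hypothesis killing : forall m q, (m0 <= m)%N -> (q < y)%N ->
  branch_tail_weight m q <= (1 - kap) * branch_tail m q.
Hypothesis jumping : forall m q, (m0 <= m)%N -> (y <= q)%N ->
  kap * branch_mass m q <= avg (fun p : wb m =>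
    ((branch_minimax p == q) && (minimax p.2 < y)%N)%:R).

(* Above level [y] the minimax value of the backbone falls below [y] with
   probability at least [kap] per step; below [y] every step costs a factor
   [1 - kap]. *)
Definition backbone_bound k : R :=
  (1 - kap) ^+ k + k%:R * kap * (1 - kap) ^+ k.-1.

(** [backbone_bound k] is the probability of at most one success in [k] independent trials of
    success probability [kap], the one success standing for the jump below [y]. The recursion
    conditions on one trial. *)
Lemma backbone_boundS k :
  backbone_bound k.+1 = (1 - kap) * backbone_bound k + kap * (1 - kap) ^+ k.
Proof.
rewrite /backbone_bound; case: k => [|k] /=; rewrite ?exprS -?natr1; ring.
Qed.

Let kap1_ge0 : 0 <= 1 - kap. Proof. by case/andP: kap01 => _; rewrite subr_ge0. Qed.
Let kap_ge0 : 0 <= kap. Proof. by case/andP: kap01. Qed.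

Lemma backbone_bound_ge k : (1 - kap) ^+ k <= backbone_bound k.
Proof. by rewrite /backbone_bound lerDl !mulr_ge0// exprn_ge0. Qed.

Let level_bound k q := if (q < y)%N then (1 - kap) ^+ k else backbone_bound k.

Let level_bound_ge0 k q : 0 <= level_bound k q.
Proof.
rewrite /level_bound; case: ifP => _; first exact: exprn_ge0.
exact: le_trans (exprn_ge0 _ kap1_ge0) (backbone_bound_ge k).
Qed.

(** Minimax values cannot rise along the backbone, so a level below [y] stays there. From above, the
    share of at least [kap] that jumps below [y] replaces the bound [A] by the smaller [B]. *)
Lemma branch_level_bound m k q : (m0 <= m)%N ->
  avg (fun p : wb m => (branch_minimax p == q)%:R * level_bound k (minimax p.2)) <=
  (if (q < y)%N then (1 - kap) ^+ k else backbone_bound k.+1) * branch_mass m q.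
Proof.
move=> m0m; case: ltnP => [qy|yq].
  rewrite -avgZl; apply: le_avg => p; case: eqP => [pq|_]; last first.
    by rewrite mul0r mulr0.
  rewrite mul1r mulr1 /level_bound (leq_ltn_trans _ qy)//.
  by rewrite -pq leq_maxr.
set B := (1 - kap) ^+ k; set A := backbone_bound k.
have AB : 0 <= A - B by rewrite subr_ge0 backbone_bound_ge.
rewrite (eq_avg (g := fun p : wb m => A * (branch_minimax p == q)%:R -
    (A - B) * ((branch_minimax p == q) && (minimax p.2 < y)%N)%:R)); last first.
  move=> p; rewrite /level_bound; case: eqP => _ /=; last by rewrite !mul0r !mulr0 subr0.
  by case: ltnP => _; rewrite /= ?mulr1 ?mul1r ?mulr0 ?subr0 ?subKr.
rewrite avgB !avgZl backbone_boundS -/A -/B.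
have := ler_wpM2l AB (jumping m0m yq); rewrite -/(branch_mass m q).
set M := branch_mass m q; set J := avg _ => hJ.
rewrite lerBlDr; apply: (@le_trans _ _ (((1 - kap) * A + kap * B) * M + (A - B) * (kap * M))).
  by rewrite le_eqVlt; apply/orP; left; apply/eqP; ring.
by rewrite lerD2l.
Qed.

Lemma avg_backbone_weight_level m k q : (m0 + k <= m)%N ->
  avg (fun t : wt m => (minimax t == q)%:R * phi k t) <=
  level_bound k q * level_mass m q.
Proof.
elim: k m q => [|k IH] m q mk.
  rewrite /level_bound /backbone_bound expr0 mul0r mul0r addr0 if_same mul1r.
  by apply: le_avg => t; rewrite {1}/phi; case: (m) t => [|?] t; rewrite mulr1.
case: m mk => [|m]; first by rewrite addnS.
rewrite addnS ltnS => mk; have m0m : (m0 <= m)%N by apply: leq_trans mk; rewrite leq_addr.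
rewrite avg_backbone_weightS.
have st (n : nat) (a b a' b' : R) : 0 <= a -> 0 <= b -> a <= a' -> b <= b' ->
    a * b ^+ n <= a' * b' ^+ n.
  move=> a0 b0 aa bb; rewrite ler_pM ?exprn_ge0//.
  by apply: lerXn2r; rewrite // nnegrE // (le_trans b0).
have a0 : 0 <= avg (fun p : wb m => (branch_minimax p == q)%:R * phi k p.2).
  by apply: avg_ge0 => p; rewrite mulr_ge0// backbone_weight_ge0.
have b0 : 0 <= branch_tail_weight m q by apply: avg_ge0 => p; rewrite mulr_ge0.
have aB : avg (fun p : wb m => (branch_minimax p == q)%:R * phi k p.2) <=
    avg (fun p : wb m => (branch_minimax p == q)%:R * level_bound k (minimax p.2)).
  (* For a fixed first index [a] the condition on the branch depends on the subtree only through its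
     minimax value, so the induction hypothesis can be averaged over levels. *)
  rewrite !avg_pair; apply: le_avg => a.
  exact: (@avg_le_levels m _ (fun q' => (maxn a q' == q)%:R)) (fun q' => IH m q' mk).
have {}aB := le_trans aB (branch_level_bound k q m0m).
have mass0 : 0 <= branch_mass m q by apply: avg_ge0.
have tail0 : 0 <= branch_tail m q by apply: avg_ge0.
apply: (@le_trans _ _ (level_bound k.+1 q *
    (s%:R * (branch_mass m q * branch_tail m q ^+ s.-1)))); last first.
  by rewrite ler_wpM2l// level_massS_ge.
rewrite [leRHS]mulrCA ler_wpM2l// [leRHS]mulrA /level_bound.
case: ltnP aB => [qy|yq] aB.
  apply: le_trans (st _ _ _ _ _ a0 b0 aB (killing m0m qy)) _.
  (* One of the [s - 1 >= 1] siblings already yields the killing factor. *)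
  have K1 : (1 - kap) ^+ s.-1 <= 1 - kap.
    rewrite -[leRHS]expr1; apply: ler_wiXn2l => //; first by rewrite gerBl.
    by rewrite -ltnS prednK.
  rewrite exprMn; move: (branch_mass m q) (branch_tail m q ^+ s.-1) mass0
    (exprn_ge0 s.-1 tail0) => M U M0 U0.
  apply: (@le_trans _ _ ((1 - kap) ^+ k * M * ((1 - kap) * U))).
    by rewrite ler_wpM2l ?mulr_ge0 ?exprn_ge0// ler_wpM2r.
  by rewrite exprSr le_eqVlt; apply/orP; left; apply/eqP; ring.
apply: st => //; apply: le_avg => p.
by rewrite ler_piMr.
Qed.

Lemma avg_backbone_weight_le m k : (m0 + k <= m)%N ->
  avg (phi k : wt m -> R) <= backbone_bound k.
Proof.
move=> mk.
apply: (@le_trans _ _ (avg (fun t : wt m => 1 * phi k t))).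
  by apply: le_avg => t; rewrite mul1r.
apply: (@le_trans _ _ (avg (fun t : wt m => 1 * level_bound k (minimax t)))).
  apply: (@avg_le_levels m _ (fun=> 1)) => [_|q]; first exact: ler01.
  exact: avg_backbone_weight_level.
rewrite -[leRHS](avg_cst _ (card_wtree_gt0 s N_gt0 m)); apply: le_avg => t.
by rewrite mul1r /level_bound; case: ifP => _ //; exact: backbone_bound_ge.
Qed.
End BackboneRecursion.

(** * Killing and jumping estimates for one backbone step *)

Section StepEstimates.
Variables (R : realType) (s N : nat).
Hypothesis s_gt1 : (1 < s)%N.
Hypothesis N_gt0 : (0 < N)%N.
Variables (c y : nat) (r : R).
Hypothesis cN : (c * s = N)%N.
Hypothesis cy : (c <= y)%N.
Hypothesis yN : (y <= N)%N.
Hypothesis r_ge0 : 0 <= r.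
Hypothesis r_le1 : r <= 1.
Hypothesis yr : y%:R / N%:R = s%:R^-1 + r :> R.

Let s_gt0 : (0 < s)%N. Proof. exact: ltnW. Qed.
Let wt := wtree s N.
Let wb := wbranch s N.
Let z := 1 - r ^+ 2.

Let z01 : 0 <= z <= 1.
Proof. by rewrite /z subr_ge0 expr_le1// r_le1 gerBl sqr_ge0. Qed.

Let zX_ge0 n : 0 <= z ^+ n. Proof. by case/andP: z01 => z0 _; exact: exprn_ge0. Qed.
Let zX_le1 n : z ^+ n <= 1. Proof. by case/andP: z01 => z0 z1; exact: exprn_ile1. Qed.

Let c_gt0 : (0 < c)%N.
Proof. by move: N_gt0; rewrite -cN muln_gt0 => /andP[]. Qed.

Let y_gt0 : (0 < y)%N. Proof. exact: leq_trans cy. Qed.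

Let c_over_N : c%:R / N%:R = s%:R^-1 :> R.
Proof. by rewrite -cN natrM invfM mulrA divff ?mul1r// pnatr_eq0 -lt0n. Qed.

Let p01 : 0 <= (y%:R / N%:R : R) <= 1.
Proof. by rewrite divr_ge0//= ler_pdivrMr ?ltr0n// mul1r ler_nat. Qed.

Let deficit m h : R :=
  avg (fun t : wt m => (y <= minimax t)%N%:R * (1 - z ^+ size (cluster c h t))).

Let a m : R := y%:R / N%:R * reach s m (y%:R / N%:R).

Lemma avg_branch_tail m :
  avg (fun p : wb m => (y <= branch_minimax p)%N%:R : R) = 1 - a m.
Proof.
rewrite /a -avg_branch_minimax_lt ?y_gt0//.
rewrite -(avg_compl _ _ (card_wbranch_gt0 s N_gt0 m)).
by apply: eq_avg => p; rewrite -leqNgt.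
Qed.

(** A branch contributes only if its first index is below [c], which has probability
    [c / N = 1 / s]. As [c <= y], its minimax value then reaches [y] exactly when that of its
    subtree does. *)
Lemma avg_branch_deficit m h :
  avg (fun p : wb m => (y <= branch_minimax p)%N%:R * (1 - z ^+ branch_size c h p)) =
  deficit m h / s%:R.
Proof.
rewrite -c_over_N mulrC -(@avg_ord_lt R N c) /deficit; last first.
  by rewrite (leq_trans cy).
rewrite -avg_pairM; apply: eq_avg => -[i t]; rewrite /branch_size /branch_minimax /=.
case: ltnP => ic; last by rewrite expr0 subrr mulr0 mul0r.
by rewrite mul1r leq_max [(y <= i)%N]leqNgt (leq_trans ic cy).
Qed.

Lemma avg_branch_tail_weight m h :
  avg (fun p : wb m => (y <= branch_minimax p)%N%:R * z ^+ branch_size c h p) =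
  1 - a m - deficit m h / s%:R.
Proof.
rewrite -avg_branch_tail -avg_branch_deficit -avgB; apply: eq_avg => p.
by rewrite mulrBr mulr1 subKr.
Qed.

(** The event [y <= minimax t] is an intersection over the branches and the cluster size is one plus
    a sum over them, so both averages factor; the root gives the factor [z]. *)
Lemma deficitS m h : deficit m.+1 h.+1 =
  (1 - a m) ^+ s - z * (1 - a m - deficit m h / s%:R) ^+ s.
Proof.
rewrite -avg_branch_tail_weight -[in (1 - a m) ^+ s]avg_branch_tail.
rewrite -[X in _ ^+ X - _](card_ord s) -[X in _ - _ * _ ^+ X](card_ord s).
rewrite -!prodr_const -!avg_prod -avgZl -avgB; apply: eq_avg => t.
have -> : (y <= minimax t)%N = [forall i, y <= branch_minimax (t i)]%N.
  rewrite leqNgt minimax_lt// negb_exists.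
  by apply: eq_forallb => i; rewrite -leqNgt.
rewrite size_clusterS exprS big_split /=.
case: forallP => [all|]; last first.
  move=> /forallP; rewrite negb_forall => /existsP[i /negPf iy].
  have -> : \prod_j (y <= branch_minimax (t j))%N%:R = 0 :> R.
    by rewrite (bigD1 i)// iy /= mul0r.
  by rewrite !(mul0r, mulr0) subrr.
have -> : \prod_j (y <= branch_minimax (t j))%N%:R = 1 :> R.
  by rewrite big1// => i _; rewrite all.
by rewrite !mul1r expr_sum.
Qed.

Variables (A : R) (m0 : nat).
Hypothesis A_ge1 : 1 <= A.
Hypothesis r_small : r * (2 * s%:R * (A + 1)) <= 1.
Hypothesis a_le : forall m, (m0 <= m)%N -> a m <= A * r.

Let a_ge0 m : 0 <= a m.
Proof. by case/andP: (p01) => p0 _; rewrite mulr_ge0// reach_ge0. Qed.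

Let deficit_le m h : deficit m h / s%:R <= 1 - a m.
Proof.
rewrite -subr_ge0 -avg_branch_tail_weight; apply: avg_ge0 => p.
exact: mulr_ge0.
Qed.

(* For [h] of order [1 / r], a critical cluster of depth [h] has size at least
   [1 / r ^+ 2] with probability of order [r]. *)
Lemma deficit_ge m h : h%:R * r <= 1 -> (m0 + h <= m)%N ->
  h%:R * (r ^+ 2 / (2 * s%:R * A + 3)) <= deficit m h.
Proof.
have E0 : 0 < 2 * s%:R * A + 3 :> R.
  by rewrite ltr_wpDl// !mulr_ge0// (le_trans ler01).
elim: h m => [|h IH] m hr mh.
  by rewrite mul0r; apply: avg_ge0 => t; rewrite mulr_ge0// subr_ge0.
have hr' : h%:R * r <= 1 by apply: le_trans hr; rewrite ler_wpM2r// ler_nat.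
case: m mh => [|m]; first by rewrite addnS.
rewrite addnS ltnS => mh; rewrite deficitS.
apply: le_trans (truncated_cluster_step s_gt1 A_ge1 r_ge0 r_small _ _
  (IH m hr' mh) (deficit_le m h)).
- by rewrite -natr1 mulrDl mul1r.
- by rewrite a_ge0 a_le// (leq_trans _ mh)// leq_addr.
- rewrite mulr_ge0 ?divr_ge0 ?sqr_ge0 ?(ltW E0)//=.
  rewrite mulrA ler_wpM2r ?invr_ge0 ?(ltW E0)//.
  by rewrite expr2 mulrA -[leRHS]mul1r ler_wpM2r.
Qed.

(** For [q < y] the loss is at least the one on [y <= branch_minimax p], which is
    [deficit m h / s >= kap]. As the tail probability is at most [1], this absolute loss is also a
    relative one. *)
Lemma killing_estimate m h q (kap : R) : h%:R * r <= 1 -> (m0 + h <= m)%N ->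
  0 <= kap -> kap * s%:R <= h%:R * (r ^+ 2 / (2 * s%:R * A + 3)) -> (q < y)%N ->
  avg (fun p : wb m => (q < branch_minimax p)%N%:R * z ^+ branch_size c h p) <=
  (1 - kap) * avg (fun p : wb m => (q < branch_minimax p)%N%:R).
Proof.
move=> hr mh kap0 kap_le qy.
rewrite mulrBl mul1r lerBrDr -lerBrDl -avgB.
apply: (@le_trans _ _ kap).
  rewrite -[leRHS]mulr1 ler_wpM2l//.
  rewrite -[leRHS](avg_cst 1 (card_wbranch_gt0 s N_gt0 m)).
  by apply: le_avg => p; rewrite lern1 leq_b1.
apply: (@le_trans _ _ (deficit m h / s%:R)).
  by rewrite ler_pdivlMr ?ltr0n//; apply: le_trans kap_le (deficit_ge hr mh).
rewrite -avg_branch_deficit; apply: le_avg => p.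
rewrite -[X in _ <= X - _]mulr1 -mulrBr ler_wpM2r ?subr_ge0//.
by rewrite ler_nat; case: (leqP y (branch_minimax p)) => // yp; rewrite (leq_trans qy yp).
Qed.

(** A branch of level [q] has first index [q] or a subtree of minimax value [q], so by the Lipschitz
    bound its probability is at most [(1 + 2 s ^ 2) / N]. First index [q] together with a subtree
    below [y] has probability at least [r / (s N)]. *)
Lemma jumping_estimate m q (kap : R) : 0 <= kap ->
  kap * s%:R * (1 + 2 * s%:R ^+ 2) <= r -> (y <= q)%N ->
  kap * avg (fun p : wb m => (branch_minimax p == q)%:R) <=
  avg (fun p : wb m => ((branch_minimax p == q) && (minimax p.2 < y)%N)%:R).
Proof.
move=> kap0 kap_le yq; have NR : 0 < N%:R :> R by rewrite ltr0n.
have [qN|Nq] := ltnP q N; last first.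
  rewrite (eq_avg (g := fun=> 0)); last first.
    move=> p; rewrite ltn_eqF// (leq_trans _ Nq)//.
    by rewrite gtn_max ltn_ord minimax_ltN.
  by rewrite avg_cst ?card_wbranch_gt0// mulr0 avg_ge0.
have q_gt0 : (0 < q)%N by exact: leq_trans yq.
have root_eq : avg (fun i : 'I_N => (i == q :> nat)%:R : R) = N%:R^-1.
  rewrite (eq_avg (g := fun i : 'I_N => (i < q.+1)%N%:R - (i < q)%N%:R)).
    by rewrite avgB !avg_ord_lt ?(ltnW qN)// -mulrBl -natrB// subSnn mul1r.
  by move=> i; rewrite ltnS; case: ltngtP; rewrite ?subrr ?subr0.
have level_le : avg (fun t : wt m => (minimax t == q)%:R : R) <=
    2 * s%:R ^+ 2 / N%:R.
  rewrite (eq_avg (g := fun t : wt m =>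
      (minimax t < q.+1)%N%:R - (minimax t < q)%N%:R)); last first.
    by move=> t; rewrite ltnS; case: ltngtP; rewrite ?subrr ?subr0.
  rewrite avgB !avg_minimax_lt ?q_gt0 ?(ltnW qN)//.
  apply: le_trans (reach_lipschitz m s_gt1 _ _ _) _.
  - apply: (@le_trans _ _ (y%:R / N%:R)); first by rewrite yr lerDl.
    by rewrite ler_wpM2r ?invr_ge0 ?(ltW NR)// ler_nat.
  - by rewrite ler_wpM2r ?invr_ge0 ?(ltW NR)// ler_nat.
  - by rewrite ler_pdivrMr// mul1r ler_nat.
  - by rewrite -mulrBl -natrB// subSnn mul1r.
have mass_le : avg (fun p : wb m => (branch_minimax p == q)%:R : R) <=
    (1 + 2 * s%:R ^+ 2) / N%:R.
  rewrite mulrDl mul1r -{1}root_eq -(avg_root_weight s N_gt0 m).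
  apply: le_trans (lerD (lexx _) level_le).
  rewrite -(avg_subtree N_gt0) -avgD; apply: le_avg => -[i t].
  rewrite /branch_minimax /= -natrD ler_nat; case: (leqP i (minimax t)) => _.
    by rewrite leq_addl.
  by rewrite leq_addr.
have reach_y : r / s%:R <= reach s m (y%:R / N%:R).
  by rewrite yr; apply: reach_ge => //; rewrite -yr; case/andP: p01.
apply: le_trans (ler_wpM2l kap0 mass_le) _.
apply: (@le_trans _ _ (N%:R^-1 * reach s m (y%:R / N%:R))).
  rewrite mulrA mulrC ler_wpM2l ?invr_ge0 ?(ltW NR)//.
  apply: le_trans reach_y; rewrite ler_pdivlMr ?ltr0n//.
  by rewrite mulrAC.
rewrite -[X in X * _ <= _]root_eq -avg_minimax_lt ?y_gt0// -avg_pairM; apply: le_avg => -[i t] /=.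
rewrite -natrM mulnb ler_nat; case: eqP => //= iq; rewrite /branch_minimax /= iq.
case: ltnP => //= ty; rewrite (maxn_idPl _) ?eqxx//.
by apply: leq_trans yq; exact: ltnW.
Qed.
End StepEstimates.

(** * Decay of the backbone weight and choice of the constants *)

Section BackboneDecay.
Variable R : realType.

(** As [kap <= 1 / 2], the left side is at most [(1 + 2 x) exp(- x)] with [x = n * kap], and
    [exp x >= ((1 + x) / 4) ^ 4] gives cubic decay. This order makes the sum over the layers,
    weighted by [k], converge. *)
Lemma backbone_bound_decay (kap : R) n : (0 < n)%N -> 0 < kap <= 1 / 2 ->
  backbone_bound kap n <= 512 / (n%:R * kap) ^+ 3.
Proof.
move=> n0 /andP[kap0 kap1]; set x := n%:R * kap.
have x0 : 0 < x by rewrite mulr_gt0// ltr0n.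
have K0 : 0 <= (1 - kap) ^+ n.-1 by apply: exprn_ge0; lra.
have ub : backbone_bound kap n <= (1 + 2 * x) * expR (- x).
  apply: (@le_trans _ _ ((1 + 2 * x) * (1 - kap) ^+ n)).
    rewrite /backbone_bound -/x mulrDl mul1r lerD2l -(prednK n0) exprS /= mulrA.
    by rewrite ler_wpM2r//; nra.
  rewrite ler_wpM2l//; first by lra.
  have -> : - x = n%:R * (- kap) by rewrite /x mulrN.
  rewrite expRM_natl; apply: lerXn2r; rewrite ?nnegrE ?expR_ge0//; first by lra.
  exact: expR_ge1Dx.
have lb : (1 + x) ^+ 4 / 256 <= expR x.
  have -> : expR x = expR (x / 4) ^+ 4 by rewrite -expRM_natl; congr expR; field.
  have h : 1 + x / 4 <= expR (x / 4) by exact: expR_ge1Dx.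
  have -> : (1 + x) ^+ 4 / 256 = ((1 + x) / 4) ^+ 4 by field.
  by apply: lerXn2r; rewrite ?nnegrE ?expR_ge0//; lra.
apply: le_trans ub _; rewrite ler_pdivlMr ?exprn_gt0// expRN.
rewrite mulrAC ler_pdivrMr ?expR_gt0//.
apply: le_trans (ler_wpM2l _ lb); last lra.
have : (1 + 2 * x) * x ^+ 3 <= 2 * (1 + x) ^+ 4.
  rewrite (_ : 2 * (1 + x) ^+ 4 = (2 * (1 + x)) * (1 + x) ^+ 3); last by ring.
  apply: ler_pM; [lra| |lra|]; first by rewrite exprn_ge0// ltW.
  by apply: lerXn2r; rewrite ?nnegrE; lra.
lra.
Qed.

(* On the grid of step [1 / (mesh s * H * N0 * s)] the critical value [1 / s] and
   the thresholds [1 / s + k / (mesh s * H)], for [k <= H], are grid points. *)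
Definition mesh (s : nat) : nat := (4 * s * (s ^ 2 + 1))%N.

(** Killing and jumping rate per backbone step in units of [r]; the inner factor is [2 s A + 3] with
    [A = 1 + 2 s ^ 2]. *)
Definition kill_rate (s : nat) : R :=
  (2 * (mesh s)%:R * (2 * s%:R * (1 + 2 * s%:R ^+ 2) + 3) * s%:R)^-1.

Definition decay_constant (s : nat) : R :=
  512 / (kill_rate s / (mesh s)%:R) ^+ 3.

Lemma avg_backbone_weight_decay (s H k N0 m : nat) :
  (1 < s)%N -> (0 < k <= H)%N -> (0 < N0)%N ->
  (s ^ 2 * mesh s * H + H + H <= m)%N ->
  avg (backbone_weight (1 - (k%:R / (mesh s * H)%:R) ^+ 2)
         (mesh s * H * N0) (H %/ k) H :
         wtree s (mesh s * H * N0 * s) m -> R) <=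
  decay_constant s / k%:R ^+ 3.
Proof.
move=> s1 /andP[k0 kH] N00 mm.
set B := mesh s in mm *.
have B0 : (0 < B)%N by rewrite /B /mesh; lia.
have H0 : (0 < H)%N by exact: leq_trans kH.
have s0 : (0 < s)%N by exact: ltnW.
have sR : 2 <= s%:R :> R by rewrite ler_nat.
have BR : 0 < B%:R :> R by rewrite ltr0n.
have HR : 0 < H%:R :> R by rewrite ltr0n.
have kR : 1 <= k%:R :> R by rewrite ler1n.
have NR : 0 < N0%:R :> R by rewrite ltr0n.
have kHR : k%:R <= H%:R :> R by rewrite ler_nat.
have BE : B%:R = 4 * s%:R * (s%:R ^+ 2 + 1) :> R.
  by rewrite /B /mesh !natrM natrD natrX.
set r : R := k%:R / (B * H)%:R.
have rE : r * (B%:R * H%:R) = k%:R.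
  by rewrite /r natrM divfK// mulf_neq0// lt0r_neq0.
have r0 : 0 < r by rewrite divr_gt0 ?ltr0n// muln_gt0 B0.
have rB : r * B%:R <= 1.
  by rewrite -(ler_pM2r HR) mul1r -mulrA rE.
(* At large depth the critical value of [reach] is at most [r], and moving to [1 / s + r] adds at
   most [2 s ^ 2 r]. *)
set A : R := 1 + 2 * s%:R ^+ 2.
have A1 : 1 <= A by rewrite lerDl mulr_ge0// sqr_ge0.
(* [mesh s] equals [2 s (A + 1)], and [r * mesh s = k / H <= 1]. *)
have rs : r * (2 * s%:R * (A + 1)) <= 1.
  apply: le_trans rB; rewrite le_eqVlt BE /A; apply/orP; left; apply/eqP; ring.
have B32 : 32 <= B%:R :> R by rewrite BE; nra.
have r1 : r <= 1 / 32 by nra.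
set N := (B * H * N0 * s)%N; set c := (B * H * N0)%N.
have N_gt0 : (0 < N)%N by rewrite 3!muln_gt0 B0 H0 N00.
set y := (c + k * N0 * s)%N.
have cy : (c <= y)%N by rewrite leq_addr.
have yr : y%:R / N%:R = s%:R^-1 + r :> R.
  rewrite /y /N /c /r natrD !natrM; field.
  by rewrite !lt0r_neq0//; lra.
have sV : s%:R^-1 <= 1 / 2 :> R by rewrite -div1r ler_pdivrMr; lra.
have sV0 : 0 < s%:R^-1 :> R by rewrite invr_gt0; lra.
have yN : (y <= N)%N.
  rewrite -(ler_nat R) -[leRHS]mul1r -ler_pdivrMr ?ltr0n// yr; lra.
set E := 2 * s%:R * A + 3.
have sA0 : 0 <= 2 * s%:R * A by apply: mulr_ge0; lra.
have E3 : 3 <= E by rewrite lerDr.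
have E0 : 0 < E by lra.
have hk : (H < (H %/ k).+1 * k)%N by rewrite -ltn_divLR.
(* Truncation depth of order [1 / r]: [h * r] lies between [1 / (2 * mesh s)] and [1]. *)
set h := (H %/ k)%N in hk *.
have h_le : (h * k <= H)%N by rewrite leq_trunc_div.
have h1 : (0 < h)%N by rewrite divn_gt0.
have hr1 : h%:R * r <= 1.
  have hkR : h%:R * k%:R <= H%:R :> R by rewrite -natrM ler_nat.
  rewrite -(ler_pM2r (mulr_gt0 BR HR)) -mulrA rE mul1r; nra.
have hr2 : 1 <= 2 * B%:R * (h%:R * r).
  rewrite -(ler_pM2r HR) mul1r.
  have -> : 2 * B%:R * (h%:R * r) * H%:R = 2 * h%:R * k%:R.
    by rewrite -rE; ring.
  have hh : (H <= 2 * h * k)%N.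
    apply: leq_trans (ltnW hk) _.
    by rewrite leq_mul2r mul2n -addnn -addn1 leq_add2l h1 orbT.
  by rewrite -!natrM ler_nat.
set kap := kill_rate s * r.
have K0 : 0 < kill_rate s.
  by rewrite invr_gt0 -/A -/E !mulr_gt0//; lra.
have KE : kill_rate s * (2 * B%:R * E * s%:R) = 1.
  by rewrite mulVf// lt0r_neq0// -invr_gt0.
have kap0 : 0 < kap by rewrite mulr_gt0.
have BE1 : 1 <= B%:R * E by apply: mulr_ege1; lra.
have kapE : kap * s%:R * (2 * B%:R * E) = r.
  by rewrite -[RHS]mulr1 -[X in _ = r * X]KE /kap; ring.
have kap1 : kap <= 1 / 2.
  have : kap <= kap * (s%:R * (2 * B%:R * E)) by rewrite ler_peMr ?ltW//; nra.
  rewrite mulrA kapE; lra.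
have r_le1 : r <= 1 by lra.
(* From this depth on the critical bound [s ^ 2 / (m' + 1)] is at most [r], because
   [r * B * H = k >= 1]. *)
pose m0 := (s ^ 2 * B * H)%N.
have a_le m' : (m0 <= m')%N ->
    y%:R / N%:R * reach s m' (y%:R / N%:R) <= A * r.
  move=> m0m; have p01 : 0 <= (y%:R / N%:R : R) <= 1 by rewrite yr; apply/andP; split; lra.
  have f0 := reach_ge0 s m' p01.
  apply: (@le_trans _ _ (reach s m' (y%:R / N%:R))).
    by case/andP: p01 => p0 p1; rewrite ler_piMl.
  rewrite yr in p01 *.
  have := @reach_lipschitz R s m' s%:R^-1 (s%:R^-1 + r) s1 (lexx _).
  rewrite lerDl (ltW r0) => /(_ isT); case/andP: p01 => _ -> /(_ isT) lip.
  have crit := @reach_critical_le R s m' s1.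
  have small : s%:R ^+ 2 / m'.+1%:R <= r :> R.
    rewrite ler_pdivrMr ?ltr0n//.
    apply: (@le_trans _ _ (r * m0%:R)); last first.
      by rewrite ler_wpM2l ?ltW// ltr_nat.
    rewrite /m0 (natrM _ (s ^ 2 * B) H) (natrM _ (s ^ 2) B) natrX.
    have -> : r * (s%:R ^+ 2 * B%:R * H%:R) = s%:R ^+ 2 * (r * (B%:R * H%:R)) by ring.
    by rewrite rE ler_peMr// sqr_ge0.
  rewrite [X in _ <= _ * X]addrAC subrr add0r in lip.
  rewrite /A mulrDl mul1r -lerBlDl.
  by apply: le_trans lip; rewrite lerD2l lerN2 (le_trans crit).
have kap_kill : kap * s%:R <= h%:R * (r ^+ 2 / E).
  rewrite -(ler_pM2r (_ : 0 < 2 * B%:R * E)); last by rewrite !mulr_gt0.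
  rewrite kapE.
  have -> : h%:R * (r ^+ 2 / E) * (2 * B%:R * E) = 2 * B%:R * (h%:R * r) * r.
    by field; rewrite lt0r_neq0.
  by rewrite ler_peMl// ltW.
have kap_jump : kap * s%:R * (1 + 2 * s%:R ^+ 2) <= r.
  have AE : A <= 2 * B%:R * E.
    have AsA : A <= s%:R * A by rewrite ler_peMl; lra.
    have EB : E <= B%:R * E by rewrite ler_peMl; lra.
    by have : E = 2 * s%:R * A + 3 by []; rewrite -mulrA; lra.
  rewrite -/A -[leRHS]kapE; apply: ler_wpM2l AE.
  by rewrite mulr_ge0// ltW.
have z01 : 0 <= 1 - r ^+ 2 <= 1.
  by rewrite gerBl sqr_ge0 andbT subr_ge0 expr_le1// ltW.
have kap01 : 0 <= kap <= 1 by rewrite ltW//=; lra.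
have hH : (h <= H)%N by exact: leq_div.
apply: (@le_trans _ _ (backbone_bound kap H)).
  apply: (avg_backbone_weight_le s1 N_gt0 z01 (y := y) (m0 := (m0 + h)%N) kap01).
  - move=> m' q mm' qy.
    exact: (killing_estimate s1 N_gt0 (erefl : (c * s)%N = N) cy yN (ltW r0) r_le1
      A1 rs a_le hr1 mm' (ltW kap0) kap_kill qy).
  - move=> m' q _ yq.
    exact: (jumping_estimate s1 N_gt0 (erefl : (c * s)%N = N) cy yN (ltW r0) yr
      m' (ltW kap0) kap_jump yq).
  - by apply: leq_trans mm; rewrite /m0 leq_add2r leq_add2l.
apply: le_trans (backbone_bound_decay H0 _) _; first by rewrite kap0.
rewrite /decay_constant -/B le_eqVlt; apply/orP; left; apply/eqP.
have -> : H%:R * kap = kill_rate s / B%:R * k%:R.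
  by rewrite /kap -rE; field; rewrite lt0r_neq0.
rewrite exprMn; field.
by rewrite !lt0r_neq0//; lra.
Qed.
End BackboneDecay.

(** * Invasion percolation *)

Section InvasionGrowth.
Variables (R : realType) (s : nat) (w : edge s -> R).
Implicit Types (x y u r : vertex s) (e f : edge s).

Local Notation I := (invasion w).
Local Notation C := (invasion_cluster w).

Fixpoint path_all (p : pred (edge s)) x r : bool :=
  if r is i :: r' then p (x, i) && path_all p (rcons x i) r' else true.

Lemma path_all_cons (p : pred (edge s)) x i r :
  path_all p x (i :: r) = p (x, i) && path_all p (rcons x i) r.
Proof. by []. Qed.

Lemma sub_path_all (p q : pred (edge s)) x r :
  (forall e, p e -> q e) -> path_all p x r -> path_all q x r.
Proof.
by move=> pq; elim: r x => //= i r IH x /andP[/pq -> /IH ->].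
Qed.

Lemma path_allPn (p : pred (edge s)) x r : ~~ path_all p x r ->
  exists r1 i r2, r = r1 ++ i :: r2 /\ ~~ p (x ++ r1, i).
Proof.
elim: r x => //= i r IH x; rewrite negb_and => /orP[np|/IH[r1 [j [r2 [-> np]]]]].
  by exists [::], i, r; rewrite cats0.
by exists (i :: r1), j, r2; split=> //; rewrite -cat_rcons.
Qed.

Lemma invasion_homo n m : (n <= m)%N -> I n `<=` I m.
Proof.
move=> /subnK <-; elim: (m - n)%N => // k IH x /IH; rewrite addSn; by left.
Qed.

Lemma invasion_root n : I n [::].
Proof. exact: (invasion_homo (leq0n n)). Qed.

Lemma boundary_invasion_parent n e :
  (forall u i, I n (rcons u i) -> I n u) -> boundary (I n) e ->
  I n e.1 /\ ~ I n (rcons e.1 e.2).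
Proof. by move=> par [//|[] np /par]. Qed.

Lemma invasion_parent n u i : I n (rcons u i) -> I n u.
Proof.
elim: n u i => [|n IH] u i; first by case: u.
case=> [/IH|[e [/(boundary_invasion_parent IH)[Ie _] _]]]; first by left.
case=> [eu|]; first by left; apply: (IH _ i); rewrite eu.
by move=> /rcons_inj[-> _]; left.
Qed.

Lemma invasion_prefix n x r : I n (x ++ r) -> I n x.
Proof.
elim/last_ind: r => [|r i IH]; first by rewrite cats0.
by rewrite -rcons_cat => /invasion_parent.
Qed.

Lemma cluster_prefix x r : C (x ++ r) -> C x.
Proof. by case=> n _ /invasion_prefix; exists n. Qed.

Lemma invasionS_new n x : I n.+1 x -> ~ I n x ->
  exists u i, [/\ x = rcons u i, I n u &
    forall e, boundary (I n) e -> w (u, i) <= w e].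
Proof.
case=> // -[e [/(boundary_invasion_parent (@invasion_parent n))[Ie nIe] emin]].
case=> [->//|->] _; exists e.1, e.2; split=> //.
by move: emin; rewrite -surjective_pairing.
Qed.

Lemma cluster_invaded u i : C (rcons u i) ->
  exists n, I n u /\ forall e, boundary (I n) e -> w (u, i) <= w e.
Proof.
case=> n _; elim: n => [|n IH]; first by case: u.
move=> In; have [/IH//|nIn] := pselect (I n (rcons u i)).
by have [u' [i' [/rcons_inj[<- <-] Iu umin]]] := invasionS_new In nIn; exists n.
Qed.

Lemma path_exit n (p : pred (edge s)) x r : I n x -> ~ I n (x ++ r) ->
  path_all p x r -> exists2 e, boundary (I n) e & p e.
Proof.
elim: r x => [|i r IH] x Ix; first by rewrite cats0.
move=> nI /= /andP[pi pr]; have [Ixi|nIxi] := pselect (I n (rcons x i)).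
  by apply: (IH (rcons x i)) => //; rewrite cat_rcons.
by exists (x, i) => //; left.
Qed.

(* When an edge of weight [a] below [x] is invaded, everything that is joined
   to [x] by edges of weight less than [a] has been invaded before. *)
Lemma cluster_lower_path x r t i : C (rcons (x ++ t) i) ->
  path_all (fun e => w e < w (x ++ t, i)) x r -> C (x ++ r).
Proof.
move=> /cluster_invaded[n [/invasion_prefix Ix emin]] lower.
have [?|nI] := pselect (I n (x ++ r)); first by exists n.
by have [e /emin] := path_exit Ix nI lower; rewrite leNgt => /negP.
Qed.

Lemma seq_argmin (T : eqType) (f : T -> R) (l : seq T) (P : T -> Prop) a :
  a \in l -> P a ->
  exists2 b, P b & forall c, c \in l -> P c -> f b <= f c.
Proof.
elim: l a => // d l IH a al Pa.
have [[b [bl Pb]]|none] := pselect (exists b, b \in l /\ P b); last first.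
  exists a => // c; rewrite inE => /predU1P[->|cl Pc]; last by case: none; exists c.
  move: al; rewrite inE => /predU1P[<-//|al]; by case: none; exists a.
have [b' Pb' b'min] := IH b bl Pb.
have [Pd|nPd] := pselect (P d); last first.
  by exists b' => // c; rewrite inE => /predU1P[->//|]; exact: b'min.
have [bd|db] := leP (f b') (f d).
  by exists b' => // c; rewrite inE => /predU1P[->//|]; exact: b'min.
exists d => // c; rewrite inE => /predU1P[->//|cl Pc].
by apply: le_trans (ltW db) _; exact: b'min.
Qed.

Lemma path_all_predT x r : path_all xpredT x r.
Proof. by elim: r x => /=. Qed.

(** A finite invaded set has finitely many boundary edges, so a lightest one exists and its child
    end is new. *)
Lemma invasion_grows n (l : seq (vertex s)) x : ~ I n x ->
  (forall y, I n y -> y \in l) -> exists2 y, I n.+1 y & ~ I n y.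
Proof.
move=> nx Il; have [e be _] := path_exit (invasion_root n) nx (path_all_predT [::] x).
have bl f : boundary (I n) f -> f \in [seq (y, i) | y <- l, i <- enum 'I_s].
  move=> /(boundary_invasion_parent (@invasion_parent n))[If _].
  by rewrite [f]surjective_pairing allpairs_f ?Il ?mem_enum.
have [f bf fmin] := seq_argmin w (bl e be) be.
have [_ nf] := boundary_invasion_parent (@invasion_parent n) bf.
exists (rcons f.1 f.2) => //; right; exists f; last by right.
by split=> // e' be'; apply: fmin => //; exact: bl.
Qed.

(** Otherwise every [I n] stays inside the finite tree below height [L], although each step adds a
    vertex. *)
Lemma cluster_reaches_height L : (0 < s)%N -> exists2 y, C y & size y = L.
Proof.
move=> s0; apply/not_exists2P => low.
have short n x : I n x -> (size x < L)%N.
  move=> Ix; rewrite ltnNge; apply/negP => Lx.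
  have [nC|] := low (take L x); last by rewrite size_takel.
  by apply: nC; exists n => //; apply: (@invasion_prefix _ _ (drop L x)); rewrite cat_take_drop.
have /finite_seqP[l lE] : finite_set (up_to_height [set: vertex s] L).
  exact: finite_up_to_height.
have Il n y : I n y -> y \in l.
  move=> Iy; have : up_to_height [set: vertex s] L y.
    by split=> //; exact: ltnW (short _ _ Iy).
  by rewrite lE.
have [S [US SI sS]] : exists S : seq (vertex s),
    [/\ uniq S, forall y, y \in S -> I (size l) y & (size l < size S)%N].
  elim: (size l) => [|n [S [US SI sS]]].
    by exists [:: [::]]; split=> // y; rewrite inE => /eqP ->.
  have nI : ~ I n (nseq L (Ordinal s0)) by move/short; rewrite size_nseq ltnn.
  have [y Iy nIy] := invasion_grows nI (Il n).
  exists (y :: S); split=> //=; first by rewrite US andbT; apply/negP => /SI.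
  by move=> x; rewrite inE => /predU1P[-> //|/SI]; left.
have := uniq_leq_size US (fun y yS => Il _ y (SI y yS)).
by rewrite leqNgt sS.
Qed.
End InvasionGrowth.

(** * Backbone and hanging clusters as sets of words *)

Section WeightsToTree.
Variables (s N : nat) (v : edge s -> 'I_N).
Implicit Types x y r p : vertex s.

Fixpoint wtree_at m x : wtree s N m :=
  if m is m'.+1 return wtree s N m
  then [ffun i => (v (x, i), wtree_at m' (rcons x i))] else tt.

Let wt := wtree s N.

Lemma wtree_atE m x i : wtree_at m.+1 x i = (v (x, i), wtree_at m (rcons x i)).
Proof. by rewrite ffunE. Qed.

Fixpoint strict_path m : wt m -> vertex s -> bool :=
  if m is m'.+1 return wt m -> vertex s -> bool
  then fun t p => if p is i :: p' then
      [forall (j | j != i), branch_minimax (t i) < branch_minimax (t j)]%N &&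
      strict_path (t i).2 p'
    else false
  else fun _ p => p == [::].

Lemma strict_path_exists m (t : wt m) : (0 < s)%N -> (0 < N)%N -> ~~ tie t ->
  exists p, strict_path t p.
Proof.
move=> s0 N0; elim: m t => [|m IH] t; first by exists [::].
move=> /=; rewrite negb_or => /andP[]; rewrite negb_exists => /forallP ntie.
rewrite negb_exists => /forallP ntie'.
have [i it] := minimax_attained s0 N0 t.
have [p ip] := IH _ (ntie' i); exists (i :: p); rewrite ip andbT.
apply/forall_inP => j ji; rewrite ltn_neqAle -it minimax_le_branch andbT it.
have := ntie i; rewrite negb_exists => /forallP/(_ j).
by rewrite negb_and eq_sym ji.
Qed.

Lemma strict_path_size m (t : wt m) p : strict_path t p -> size p = m.
Proof.
elim: m t p => [t p /eqP -> //|m IH t [//|i p] /andP[_ /IH sp]].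
by rewrite /= sp.
Qed.

Lemma strict_path_minimax m (t : wt m.+1) i p : strict_path t (i :: p) ->
  minimax t = branch_minimax (t i).
Proof.
by move=> /andP[/forall_inP imin _]; apply: minimax_strict => j /imin.
Qed.

Lemma strict_path_le m x p : strict_path (wtree_at m x) p ->
  path_all (fun e => v e <= minimax (wtree_at m x))%N x p.
Proof.
elim: m x p => [|m IH] x [|i p] // ip; have tE := strict_path_minimax ip.
rewrite path_all_cons tE wtree_atE leq_maxl andTb.
case/andP: ip => _; rewrite wtree_atE /= => /IH; apply: sub_path_all => e ev.
by apply: leq_trans ev _; rewrite leq_maxr.
Qed.

Lemma minimax_wtree_at_lt m x r k : (0 < k <= N)%N -> size r = m ->
  path_all (fun e => v e < k)%N x r -> (minimax (wtree_at m x) < k)%N.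
Proof.
move=> /andP[k0 kN]; elim: m x r => [//|m IH] x [//|i r] [sr] /andP[vi pr].
rewrite minimax_lt//; apply/existsP; exists i.
by rewrite wtree_atE gtn_max vi; exact: IH pr.
Qed.

(** The path [p2] to the bottom level crosses level [k], and its end piece shows that the crossing
    point is low. *)
Lemma low_vertex_path c k m x p1 p2 : (0 < c <= N)%N -> (k <= m)%N ->
  (size p1 <= k)%N -> size (p1 ++ p2) = m ->
  path_all (fun e => v e < c)%N (x ++ p1) p2 -> low_vertex c k (wtree_at m x).
Proof.
move=> cN; elim: k m x p1 p2 => [|k IH] m x p1 p2.
  move=> _; rewrite leqn0 size_eq0 => /eqP ->; rewrite cats0 => sp pc.
  by have := minimax_wtree_at_lt cN sp pc; case: (m).
case: m => // m km; case: p1 => [|j p1] sp1.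
  case: p2 => // i p2 [sp2]; rewrite cats0 => /andP[_ pc].
  apply/existsP; exists i; rewrite wtree_atE.
  by apply: (IH _ _ [::] p2) => //; rewrite cats0.
case=> sp pc; apply/existsP; exists j; rewrite wtree_atE.
by apply: (IH _ _ p1 p2) => //; rewrite cat_rcons.
Qed.

Lemma mem_branch_cluster c m h i (b : wbranch s N m) r :
  r \in branch_cluster c h i b -> exists r', r = i :: r'.
Proof.
by rewrite /branch_cluster; case: ifP => // _ /mapP[r' _ ->]; exists r'.
Qed.

Lemma uniq_flatten_heads (F : 'I_s -> seq (vertex s)) (l : seq 'I_s) :
  uniq l -> (forall i, uniq (F i)) ->
  (forall i r, r \in F i -> exists r', r = i :: r') ->
  uniq (flatten [seq F i | i <- l]).
Proof.
move=> + uF hF; elim: l => //= i l IH /andP[il ul].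
rewrite cat_uniq uF IH// andbT; apply/hasPn => r /flatten_mapP[j jl rj].
apply/negP => ri; have [r1 r1E] := hF _ _ ri; have [r2 r2E] := hF _ _ rj.
by move: r1E il; rewrite r2E => -[<- _]; rewrite jl.
Qed.

Lemma uniq_cluster c m h (t : wt m) : uniq (cluster c h t).
Proof.
elim: m h t => [|m IH] [|h] t //=; apply/andP; split.
  apply/negP => /flatten_mapP[i _].
  by move=> /(@mem_branch_cluster c m h i (t i))[].
apply: (@uniq_flatten_heads (fun i => branch_cluster c h i (t i))).
- exact: enum_uniq.
- move=> i; rewrite /branch_cluster; case: ifP => // _.
  by rewrite map_inj_uniq// => ? ? [].
- by move=> i r; exact: mem_branch_cluster.
Qed.

Lemma uniq_branch_cluster c m h i (b : wbranch s N m) :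
  uniq (branch_cluster c h i b).
Proof.
rewrite /branch_cluster; case: ifP => // _.
by rewrite map_inj_uniq ?uniq_cluster// => ? ? [].
Qed.

Lemma mem_cluster c m h x r : r \in cluster c h (wtree_at m x) ->
  (size r <= h)%N /\ path_all (fun e => v e < c)%N x r.
Proof.
elim: m h x r => [|m IH] [|h] x r; try by rewrite inE => /eqP ->.
rewrite inE => /predU1P[->//|/flatten_mapP[i _]]; rewrite wtree_atE /=.
by case: ifP => // vi /mapP[r' /IH[sr pr] ->] /=; rewrite vi.
Qed.

Fixpoint off_backbone (c h m k : nat) : wt m -> vertex s -> seq (vertex s) :=
  match m, k return wt m -> vertex s -> seq (vertex s) with
  | m'.+1, k'.+1 => fun t p => if p is i :: p' then
      flatten [seq branch_cluster c h j (t j) | j <- enum 'I_s & j != i] ++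
      map (cons i) (off_backbone c h k' (t i).2 p')
    else [::]
  | _, _ => fun _ _ => [::]
  end.

(** Two siblings cannot each be strictly below the other, so only the terms along [p] survive. *)
Lemma backbone_weight_strict (R : realType) (z : R) c h m k (t : wt m) p :
  strict_path t p ->
  backbone_weight z c h k t = z ^+ size (off_backbone c h k t p).
Proof.
elim: m k t p => [|m IH] [|k] t [|i p] //= /andP[/forall_inP imin ip].
rewrite (bigD1 i)//= [X in _ + X]big1 ?addr0; last first.
  move=> j ji; rewrite (bigD1 i)/=; last by rewrite eq_sym.
  by rewrite ltnNge ltnW ?imin// !mul0r mulr0.
rewrite (IH _ _ _ ip) size_cat size_map addnC exprD; congr (_ * _).
rewrite size_flatten sumnE 2!big_map big_filter big_enum_cond /= expr_sum.
by apply: eq_bigr => j ji; rewrite imin// mul1r size_branch_cluster.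
Qed.

Lemma uniq_off_backbone c h m k (t : wt m) p : uniq (off_backbone c h k t p).
Proof.
elim: m k t p => [|m IH] [|k] t [|i p] //=.
rewrite cat_uniq map_inj_uniq ?IH ?andbT; last by move=> ? ? [].
rewrite (uniq_flatten_heads (F := fun j => branch_cluster c h j (t j))) /=.
- apply/hasPn => y /mapP[y' _ ->]; apply/negP => /flatten_mapP[j].
  rewrite mem_filter => /andP[ji _] /mem_branch_cluster[r [ij _]].
  by rewrite ij eqxx in ji.
- by rewrite filter_uniq// enum_uniq.
- by move=> j; exact: uniq_branch_cluster.
- by move=> j r; exact: mem_branch_cluster.
Qed.

Lemma mem_off_backbone c h m k x p y :
  y \in off_backbone c h k (wtree_at m x) p ->
  exists p1 p2 r, [/\ p = p1 ++ p2, (size p1 < k)%N, y = p1 ++ r,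
    (size r <= h.+1)%N & path_all (fun e => v e < c)%N (x ++ p1) r].
Proof.
elim: m k x p y => [|m IH] [|k] x [|i p] y //.
rewrite mem_cat => /orP[/flatten_mapP[j _]|/mapP[y']].
  rewrite wtree_atE /branch_cluster /=; case: ifP => // vj /mapP[r /mem_cluster[sr pr] ->].
  by exists [::], (i :: p), (j :: r); split=> //=; rewrite cats0 vj.
rewrite wtree_atE => /IH[p1 [p2 [r [-> sp1 -> sr pr]]]] ->.
by exists (i :: p1), p2, r; split=> //; rewrite -cat_rcons.
Qed.
End WeightsToTree.

(** * The backbone and its hanging clusters are invaded *)

Section InvasionBackbone.
Variables (R : realType) (s N : nat) (w : edge s -> R) (v : edge s -> 'I_N).
Hypothesis s_gt0 : (0 < s)%N.
Hypothesis N_gt0 : (0 < N)%N.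
Hypothesis v_homo : forall e f, w e <= w f -> (v e <= v f)%N.
Implicit Types x y r p : vertex s.

Local Notation C := (invasion_cluster w).

Let v_lt e f : (v e < v f)%N -> w e < w f.
Proof. by apply: contraTT; rewrite -leNgt -leqNgt => /v_homo. Qed.

(** Some edge of index at least [a] on the way from [x] to [x ++ y] is invaded; everything joined to
    [x] by smaller indices comes first. *)
Lemma cluster_low_path a x y r : C (x ++ y) ->
  ~~ path_all (fun e => v e < a)%N x y -> path_all (fun e => v e < a)%N x r ->
  C (x ++ r).
Proof.
move=> Cy /path_allPn[r1 [i [r2 [yE]]]]; rewrite -leqNgt => va pr.
apply: (@cluster_lower_path _ _ w x r r1 i).
  apply: (@cluster_prefix _ _ _ _ r2); rewrite -cats1 -!catA /= -yE.
  exact: Cy.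
by apply: sub_path_all pr => e ve; apply: v_lt; exact: leq_trans ve va.
Qed.

(** Follow an invaded path to the bottom level. Where it leaves the backbone for [j], it has to use
    an index of at least [b], the minimax value of that branch, while by strictness all indices on
    the rest of the backbone are below [b]. *)
Lemma strict_path_invaded m x y p : strict_path (wtree_at v m x) p ->
  C (x ++ y) -> size y = m -> C (x ++ p).
Proof.
elim: m x y p => [|m IH] x [|j y] [|i p] //= ip Cy [sy].
have [ij|ij] := eqVneq j i.
  rewrite -cat_rcons; apply: (IH _ y) => //; last by rewrite cat_rcons -ij.
  by case/andP: ip; rewrite ffunE.
have ple := strict_path_le (ip : strict_path (wtree_at v m.+1 x) (i :: p)).
have tE := strict_path_minimax (ip : strict_path (wtree_at v m.+1 x) (i :: p)).
have lt_ij : (branch_minimax (wtree_at v m.+1 x i) <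
              branch_minimax (wtree_at v m.+1 x j))%N.
  by case/andP: ip => /forall_inP/(_ _ ij).
set b := branch_minimax (wtree_at v m.+1 x j) in lt_ij *.
apply: (@cluster_low_path b x (j :: y)) => //.
  have b0N : (0 < b <= N)%N by rewrite (leq_ltn_trans _ lt_ij)// branch_minimax_le.
  apply/negP; rewrite path_all_cons => /andP[vj /(minimax_wtree_at_lt b0N sy) yb].
  suff : (b < b)%N by rewrite ltnn.
  by rewrite {1}/b wtree_atE gtn_max vj.
by apply: sub_path_all ple => e; rewrite tE => /leq_ltn_trans; apply.
Qed.

(** The cluster reaches height [m], so the backbone is invaded. Without low vertices its remainder
    [p2] contains an index of at least [c], and the hanging cluster is invaded before that edge. *)
Lemma off_backbone_invaded c h m k p y : (0 < c <= N)%N -> (k <= m)%N ->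
  strict_path (wtree_at v m [::]) p -> ~~ low_vertex c k (wtree_at v m [::]) ->
  y \in off_backbone c h k (wtree_at v m [::]) p ->
  C y /\ (size y <= k + h)%N.
Proof.
move=> cN km sp nlow /mem_off_backbone[p1 [p2 [r [pE sp1 -> sr pr]]]].
(* The strict [size p1 < k] makes up for the edge into the branch counted in [size r <= h.+1]. *)
split; last by have := leq_add sp1 sr; rewrite size_cat addSn addnS ltnS.
have [y0 Cy0 sy0] := @cluster_reaches_height _ _ w m s_gt0.
have Cp : C ([::] ++ p) by apply: (strict_path_invaded sp (y := y0)).
apply: (@cluster_low_path c p1 p2) => //; first by rewrite -pE.
apply: contra nlow => p2c.
apply: (low_vertex_path (x := [::]) cN km (ltnW sp1) _ p2c).
by rewrite -pE; exact: strict_path_size sp.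
Qed.

Lemma expr_count_le_backbone_weight (z : R) c h m k n :
  (0 < c <= N)%N -> (k <= m)%N -> (k + h <= n)%N -> 0 <= z <= 1 ->
  ~~ tie (wtree_at v m [::]) -> ~~ low_vertex c k (wtree_at v m [::]) ->
  z ^+ count_up_to_height C n <= backbone_weight z c h k (wtree_at v m [::]).
Proof.
move=> cN km khn /andP[z0 z1] ntie nlow.
have [p sp] := strict_path_exists s_gt0 N_gt0 ntie.
rewrite (backbone_weight_strict _ _ _ _ sp); apply: ler_wiXn2l => //.
rewrite /count_up_to_height; apply: uniq_leq_size.
  exact: uniq_off_backbone.
move=> y /(off_backbone_invaded cN km sp nlow)[Cy sy].
rewrite in_fset_set ?inE; last exact: finite_up_to_height.
by split=> //; exact: leq_trans khn.
Qed.
End InvasionBackbone.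

(** * Law of the rounded weights *)

Section Discretisation.
Variables (R : realType) (N : nat).
Hypothesis N_gt0 : (0 < N)%N.

Let grid_subproof (x : R) : (minn (Num.truncn (N%:R * x)) N.-1 < N)%N.
Proof. by rewrite gtn_min prednK// leqnn orbT. Qed.

Definition grid (x : R) : 'I_N := Ordinal (grid_subproof x).

Lemma grid_homo x y : x <= y -> (grid x <= grid y)%N.
Proof.
move=> xy; rewrite /= leq_min geq_minr andbT; apply: leq_trans (geq_minl _ _) _.
by apply: le_truncn; rewrite ler_wpM2l.
Qed.

Lemma grid_lt x k : (0 < k < N)%N -> (grid x < k)%N = (x < k%:R / N%:R).
Proof.
move=> /andP[k0 kN]; rewrite /= gtn_min [X in _ || X](_ : _ = false); last first.
  by apply/negbTE; rewrite -leqNgt -ltnS prednK.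
by rewrite orbF -(prednK k0) ltnS truncn_le_nat ltr_pdivlMr ?ltr0n// mulrC.
Qed.

Lemma uniform_prob_below (p : R) : 0 < p < 1 ->
  uniform_prob (@ltr01 R) `]-oo, p[%classic = p%:E.
Proof.
move=> /andP[p0 p1]; rewrite /uniform_prob integral_uniform_pdf.
rewrite (_ : _ `&` _ = `[0, p[%classic); last first.
  apply/seteqP; split=> x /=; rewrite !in_itv /=.
    by case=> xp /andP[-> _].
  by move=> /andP[-> xp]; rewrite (ltW (lt_trans xp p1)).
rewrite (eq_integral (fun=> 1%:E)); last first.
  move=> x; rewrite inE /= in_itv /= /uniform_pdf => /andP[-> xp].
  by rewrite (ltW (lt_trans xp p1)) subr0 invr1.
by rewrite integral_cst//= mul1e lebesgue_measure_itv /= lte_fin p0 -EFinB subr0.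
Qed.

Let below k := [set x : R | (grid x < k)%N].

Let belowE k : (0 < k < N)%N -> below k = `]-oo, (k%:R / N%:R)[%classic.
Proof.
by move=> kN; apply/seteqP; split=> x; rewrite /below /= in_itv /= grid_lt.
Qed.

Let below_full k : (N <= k)%N -> below k = setT.
Proof. by move=> Nk; rewrite -subTset => x _; exact: leq_trans (ltn_ord _) Nk. Qed.

Let measurable_below k : measurable (below k).
Proof.
have [Nk|kN] := leqP N k; first by rewrite below_full.
have [k0|k0] := posnP k; last by rewrite belowE ?k0.
by rewrite (_ : below k = set0)// -subset0 => x; rewrite /below /= k0.
Qed.

Let prob_below k : (k <= N)%N ->
  uniform_prob (@ltr01 R) (below k) = (k%:R / N%:R)%:E.
Proof.
move=> kN; have [->|k0] := posnP k.
  rewrite mul0r (_ : below 0 = set0) ?measure0//.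
  by rewrite -subset0 => x.
move: kN; rewrite leq_eqVlt => /predU1P[->|kN].
  by rewrite below_full// probability_setT divff// pnatr_eq0 -lt0n.
rewrite belowE ?k0// uniform_prob_below// divr_gt0 ?ltr0n//=.
by rewrite ltr_pdivrMr ?ltr0n// mul1r ltr_nat.
Qed.

Let grid_fiberE (a : 'I_N) : [set x : R | grid x = a] = below a.+1 `\` below a.
Proof.
apply/seteqP; split=> x; rewrite /below /mkset.
  by move=> <-; split=> /=; [exact: ltnSn|rewrite ltnn].
move=> [xa /negP]; rewrite -leqNgt => ax; apply/val_inj/eqP.
by rewrite eqn_leq ax andbT -ltnS.
Qed.

Lemma measurable_grid_fiber (a : 'I_N) : measurable [set x : R | grid x = a].
Proof. by rewrite grid_fiberE; exact: measurableD. Qed.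

Lemma prob_grid_fiber (a : 'I_N) :
  uniform_prob (@ltr01 R) [set x : R | grid x = a] = (N%:R^-1)%:E.
Proof.
have fin : (uniform_prob (@ltr01 R) (below a.+1) < +oo)%E.
  by rewrite prob_below ?ltry.
rewrite grid_fiberE.
have := @measureD _ _ R (uniform_prob (@ltr01 R) : {measure set _ -> \bar R})
  _ _ (measurable_below a.+1) (measurable_below a) fin.
rewrite setIidr => [->|x]; last by rewrite /below /mkset => /leq_trans; apply.
by rewrite [X in (X - _)%E]prob_below// [X in (_ - X)%E]prob_below ?(ltnW (ltn_ord a))//
  -EFinB -mulrBl -natrB// subSnn mul1r.
Qed.
End Discretisation.

Section WeightLookup.
Variables (s N : nat) (a0 : 'I_N).

Fixpoint weight_at m : wtree s N m -> vertex s -> 'I_s -> 'I_N :=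
  if m is m'.+1 return wtree s N m -> vertex s -> 'I_s -> 'I_N
  then fun t u i => if u is j :: u' then weight_at (t j).2 u' i else (t i).1
  else fun _ _ _ => a0.

Lemma wtree_atP (v : edge s -> 'I_N) m x (t : wtree s N m) :
  wtree_at v m x = t <->
  forall u i, (size u < m)%N -> v (x ++ u, i) = weight_at t u i.
Proof.
elim: m x t => [|m IH] x t; first by case: t.
split=> [<- [|j u] i /=|vt].
- by rewrite cats0 ffunE.
- rewrite ltnS ffunE /= -cat_rcons => um.
  exact: (IH (rcons x j) _).1 erefl u i um.
apply/ffunP => i; rewrite ffunE; have := vt [::] i isT; rewrite cats0 /= => ->.
rewrite [RHS]surjective_pairing; congr pair; apply/IH => u j um.
by rewrite cat_rcons; exact: (vt (i :: u) j).
Qed.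
End WeightLookup.

Section ConfigurationLaw.
Context d (T : measurableType d) (R : realType) (P : probability T R).
Variables (s N : nat) (w : edge s -> {RV P >-> R}).
Hypothesis s_gt0 : (0 < s)%N.
Hypothesis N_gt0 : (0 < N)%N.
Hypothesis hw : iid_uniform01 w.

Definition config m (x : T) : wtree s N m :=
  wtree_at (fun e => grid N_gt0 (w e x)) m [::].

Let wt := wtree s N.

Lemma finite_edges_below m : finite_set [set e : edge s | (size e.1 < m)%N].
Proof.
apply: (@sub_finite_set _ _ (up_to_height [set: vertex s] m `*` [set: 'I_s])).
  by move=> [u i] /= um; split=> //; split=> //; exact: ltnW.
by apply: finite_setX; [exact: finite_up_to_height|exact: finite_finset].
Qed.

Let edges_below m := fset_set [set e : edge s | (size e.1 < m)%N].

Let a0 : 'I_N := Ordinal N_gt0.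

Let fiber m (t : wt m) (e : edge s) : set R :=
  [set r | grid N_gt0 r = weight_at a0 t e.1 e.2].

Lemma config_fiberE m (t : wt m) : [set x | config m x = t] =
  \bigcap_(e in [set` edges_below m]) (w e @^-1` fiber t e).
Proof.
have mem e : [set` edges_below m] e <-> (size e.1 < m)%N.
  by rewrite /= in_fset_set ?inE//; exact: finite_edges_below.
apply/seteqP; split=> x.
  by move=> /(wtree_atP a0) xt e /mem em; rewrite /preimage /fiber /= -xt// -surjective_pairing.
by move=> xt; apply/(wtree_atP a0) => u i um; apply: (xt (u, i)); apply/mem.
Qed.

Lemma measurable_config_fiber m (t : wt m) : measurable [set x | config m x = t].
Proof.
rewrite config_fiberE; apply: fin_bigcap_measurable => // e _.
by rewrite -[X in measurable X]setTI; apply: measurable_funP => //; exact: measurable_grid_fiber.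
Qed.

(** By independence each configuration has probability [N] to the power minus the number of edges;
    that this does not depend on [t] makes the configuration uniform. *)
Lemma prob_config_fiber m : exists2 c : R, 0 <= c &
  forall t : wt m, P [set x | config m x = t] = c%:E.
Proof.
exists (\prod_(e <- edges_below m) N%:R^-1).
  by apply: prodr_ge0 => e _; rewrite invr_ge0.
move=> t; case: hw => indep unif; rewrite config_fiberE indep; last first.
  by move=> e; exact: measurable_grid_fiber.
rewrite -prodEFin; apply: eq_bigr => e _.
rewrite -(prob_grid_fiber R N_gt0 (weight_at a0 t e.1 e.2)).
by rewrite -(unif e)//; exact: measurable_grid_fiber.
Qed.

Lemma integral_config m (g : wt m -> R) : (forall t, 0 <= g t) ->
  (\int[P]_x (g (config m x))%:E = (avg g)%:E)%E.
Proof.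
have [c c0 Pc] := prob_config_fiber m.
have key (f : wt m -> R) : (forall t, 0 <= f t) ->
    (\int[P]_x (f (config m x))%:E = (\sum_t f t * c)%:E)%E.
  move=> f0.
  rewrite (eq_integral (fun x => \sum_t (f t)%:E *
      (\1_[set x | config m x = t] x)%:E)%E); last first.
    move=> x _; rewrite (bigD1 (config m x))//= indicE mem_set// mule1 big1 ?adde0//.
    move=> t /eqP xt; rewrite indicE memNset ?mule0// => /esym; exact: xt.
  rewrite ge0_integral_sum//; last 2 first.
  - move=> t; apply/measurable_EFinP/measurable_funM => //.
    exact: measurable_indic (measurable_config_fiber t).
  - by move=> t x _; rewrite -EFinM lee_fin mulr_ge0.
  rewrite -sumEFin; apply: eq_bigr => t _.
  rewrite ge0_integralZl_EFin//; last first.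
  - by apply/measurable_EFinP; exact: measurable_indic (measurable_config_fiber t).
  rewrite integral_indic//; last exact: measurable_config_fiber.
  by rewrite setIT EFinM; congr (_ * _)%E; exact: Pc.
(* Total mass one identifies [c] without counting edges. *)
have cE : c * #|wt m|%:R = 1.
  have := key (fun=> 1) (fun _ => ler01).
  have -> : (\int[P]_x 1%:E = 1)%E.
    by rewrite integral_cst// mul1e; exact: probability_setT.
  by rewrite -mulr_suml sumr_const => -[e]; rewrite mulrC [RHS]e.
move=> g0; rewrite key// -mulr_suml /avg; congr (_ * _)%:E.
have c_neq0 : #|wt m|%:R != 0 :> R by rewrite pnatr_eq0 -lt0n card_wtree_gt0.
by apply: (mulIf c_neq0); rewrite cE mulVf.
Qed.

(* The integrand need not be known to be measurable: the integral of a
   nonnegative function is a supremum over the simple functions below it. *)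
Lemma ge0_le_integral_dominated (f g : T -> R) :
  (forall x, 0 <= f x) -> (forall x, f x <= g x) ->
  (\int[P]_x (f x)%:E <= \int[P]_x (g x)%:E)%E.
Proof.
move=> f0 fg; rewrite !ge0_integralTE => [|x|x].
- apply: ub_ereal_sup => _ [h hf <-]; apply: ereal_sup_ubound; exists h => // x.
  by apply: le_trans (hf x) _; rewrite lee_fin.
- by rewrite lee_fin (le_trans (f0 x)).
- by rewrite lee_fin.
Qed.
End ConfigurationLaw.

(** * The uniform bound *)

Section LayerSum.
Variable R : realType.

Lemma sum_inv_sq_le2 n : \sum_(k < n) (k.+1%:R ^+ 2)^-1 <= 2 :> R.
Proof.
case: n => [|n]; first by rewrite big_ord0.
suff h : \sum_(k < n.+1) (k.+1%:R ^+ 2)^-1 <= 2 - n.+1%:R^-1 :> R.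
  by apply: le_trans h _; rewrite gerBl invr_ge0.
elim: n => [|n IH]; first by rewrite big_ord1 expr1n invr1; lra.
rewrite big_ord_recr /=; apply: le_trans (lerD IH (lexx _)) _.
have n0 : 0 <= n%:R :> R by rewrite ler0n.
rewrite -subr_ge0 -!natr1; set a : R := n%:R in n0 *.
rewrite [X in 0 <= X](_ : _ = ((a + 1) * (a + 1 + 1) ^+ 2)^-1).
  by rewrite invr_ge0 mulr_ge0 ?sqr_ge0//; lra.
by field; rewrite !lt0r_neq0//; lra.
Qed.

(** Summation by layers, with [(k + 2) ^ 2 - (k + 1) ^ 2 = 2 k + 3 <= 3 (k + 1)]. *)
Lemma sq_layers_le H (x : R) : x <= H.+1%:R ^+ 2 ->
  x <= 1 + \sum_(k < H) 3 * k.+1%:R * (k.+1%:R ^+ 2 <= x)%R%:R.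
Proof.
elim: H x => [|H IH] x; first by rewrite expr1n big_ord0 addr0.
move=> xH; rewrite big_ord_recr /=.
have [xl|xl] := leP x (H.+1%:R ^+ 2).
  by apply: le_trans (IH x xl) _; rewrite lerD2l lerDl mulr_ge0.
rewrite (ltW xl) mulr1.
have {}IH := IH _ (lexx (H.+1%:R ^+ 2)).
apply: le_trans xH _; rewrite addrA.
have step : H.+2%:R ^+ 2 <= H.+1%:R ^+ 2 + 3 * H.+1%:R :> R.
  rewrite -!natr1; have : 0 <= H%:R :> R by rewrite ler0n.
  by rewrite !expr2; nra.
apply: le_trans step _; rewrite lerD2r; apply: le_trans IH _; rewrite lerD2l.
apply: ler_sum => k _; rewrite ler_wpM2l// ler_nat.
have [kH|//] := boolP (k.+1%:R ^+ 2 <= H.+1%:R ^+ 2 :> R).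
by rewrite (le_trans kH (ltW xl)).
Qed.

(** On the event, [C r ^ 2 <= 1 / B ^ 2 <= 1 / 4], so Bernoulli's inequality bounds the power below
    by [1 / 2]. *)
Lemma layer_indicator_le (k H B C : nat) : (0 < C)%N -> (2 <= B)%N -> (k < H)%N ->
  (k.+1%:R ^+ 2 <= (H%:R ^+ 2 / C%:R : R))%R%:R <=
  2 * (1 - (k.+1%:R / (B * H)%:R) ^+ 2) ^+ C :> R.
Proof.
move=> C0 B2 kH; set r : R := k.+1%:R / (B * H)%:R.
have CR : 1 <= C%:R :> R by rewrite ler1n.
have HR : 0 < H%:R :> R by rewrite ltr0n (leq_trans _ kH).
have BR : 2 <= B%:R :> R by rewrite ler_nat.
have kHR : k.+1%:R <= H%:R :> R by rewrite ler_nat.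
have rE : r ^+ 2 * (B%:R ^+ 2 * H%:R ^+ 2) = k.+1%:R ^+ 2.
  by rewrite -!exprMn /r natrM divfK// mulf_neq0// lt0r_neq0//; lra.
have B4 : 4 <= B%:R ^+ 2 :> R by rewrite expr2; nra.
have H2 : 0 < H%:R ^+ 2 :> R by rewrite exprn_gt0.
have r2 : 0 <= r ^+ 2 <= 1.
  rewrite sqr_ge0/= -(ler_pM2r H2) mul1r.
  apply: (@le_trans _ _ (r ^+ 2 * (B%:R ^+ 2 * H%:R ^+ 2))).
    by rewrite ler_wpM2l ?sqr_ge0// ler_peMl ?(ltW H2)//; lra.
  by rewrite rE; apply: lerXn2r; rewrite ?nnegrE// ltW.
have z0 : 0 <= (1 - r ^+ 2) ^+ C by apply: exprn_ge0; lra.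
have [kC|_] := boolP (k.+1%:R ^+ 2 <= _); last by rewrite mulr_ge0.
have := bernoulli_sub C r2; suff : C%:R * r ^+ 2 <= 1 / 2.
  by rewrite /=; lra.
move: kC; rewrite ler_pdivlMr; last lra.
rewrite -rE => kC.
rewrite -(ler_pM2r H2); set u := C%:R * r ^+ 2 * H%:R ^+ 2.
have u0 : 0 <= u by rewrite !mulr_ge0 ?sqr_ge0//; lra.
have : B%:R ^+ 2 * u <= H%:R ^+ 2.
  by apply: le_trans kC; rewrite le_eqVlt; apply/orP; left; apply/eqP; rewrite /u; ring.
nra.
Qed.
End LayerSum.

Lemma decay_constant_ge0 (R : realType) (s : nat) : 0 <= decay_constant R s.
Proof.
apply: divr_ge0; first exact: ler0n.
apply/exprn_ge0/divr_ge0; last exact: ler0n.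
rewrite invr_ge0; apply: mulr_ge0; last exact: ler0n.
apply: mulr_ge0; first by apply: mulr_ge0; exact: ler0n.
apply: addr_ge0; last exact: ler0n.
apply: mulr_ge0; first by apply: mulr_ge0; exact: ler0n.
apply: addr_ge0; first exact: ler01.
by apply: mulr_ge0; [exact: ler0n|exact: sqr_ge0].
Qed.

Lemma count_up_to_height_gt0 (R : realType) (s n : nat) (w : edge s -> R) :
  (0 < count_up_to_height (invasion_cluster w) n)%N.
Proof.
rewrite cardfs_gt0; apply/fset0Pn; exists [::].
rewrite in_fset_set ?inE; last exact: finite_up_to_height.
by split=> //; exists 0%N.
Qed.

Section UniformBound.
Context d (T : measurableType d) (R : realType) (P : probability T R).
Variables (s : nat) (w : edge s -> {RV P >-> R}).
Hypothesis s_gt1 : (1 < s)%N.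
Hypothesis hw : iid_uniform01 w.

Let s_gt0 : (0 < s)%N. Proof. exact: ltnW. Qed.

Let count n x : nat := count_up_to_height (invasion_cluster (fun e => w e x)) n.

Lemma expected_ratio_le n :
  (\int[P]_x (n%:R ^+ 2 / (count n x)%:R)%:E <=
   (27 + 108 * decay_constant R s)%:E)%E.
Proof.
have D0 := decay_constant_ge0 R s.
have f0 x : 0 <= n%:R ^+ 2 / (count n x)%:R :> R by rewrite divr_ge0// sqr_ge0.
have fn x : n%:R ^+ 2 / (count n x)%:R <= n%:R ^+ 2 :> R.
  rewrite ler_pdivrMr ?ltr0n ?count_up_to_height_gt0//.
  by rewrite ler_peMr ?sqr_ge0// ler1n count_up_to_height_gt0.
(* Half of the height is for the backbone and half for the hanging clusters, whose depth [H %/ k.+1]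
   is at most [H]. *)
set H := n./2.
have n3H : (1 < n)%N -> (n <= 3 * H)%N.
  move=> n1; have := odd_double_half n; rewrite -/H.
  have : (odd n <= 1)%N by case: odd.
  have : (0 < H)%N by rewrite half_gt0.
  lia.
have n2H : (2 * H <= n)%N.
  by rewrite mul2n -[leqRHS]odd_double_half leq_addl.
have [n1|n1] := leqP n 1.
  apply: (@le_trans _ _ (\int[P]_x (1%:E))%E).
    apply: ge0_le_integral_dominated => // x; apply: le_trans (fn x) _.
    by rewrite expr_le1// lern1.
  have -> : (\int[P]_x 1%:E = 1)%E.
    by rewrite integral_cst// mul1e; exact: probability_setT.
  by rewrite lee_fin; lra.
have H0 : (0 < H)%N by rewrite half_gt0.
have HR : 1 <= H%:R :> R by rewrite ler1n.
set B := mesh s.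
(* The summand [s ^ H * s ^ 2 * H ^ 2] brings the probability of a low vertex down to [1 / H ^ 2];
   the others provide the depth that [avg_backbone_weight_decay] asks for. *)
pose m := (H + (s ^ H * s ^ 2 * H ^ 2 + s ^ 2 * B * H + H))%N.
(* Makes the grid fine enough for the tie probability to be at most [1 / H ^ 2]. *)
pose N0 := (m ^ 2 * s ^ m.+1 * H ^ 2)%N.
pose c := (B * H * N0)%N.
pose N := (c * s)%N.
have m0 : (0 < m)%N by rewrite /m addn_gt0 H0.
have N00 : (0 < N0)%N by rewrite !muln_gt0 !expn_gt0 m0 s_gt0 H0.
have B0 : (1 < B)%N.
  by rewrite /B /mesh -mulnA (leq_trans (_ : 2 <= 4)%N)// leq_pmulr// muln_gt0 s_gt0 addn1.
have c0 : (0 < c)%N by rewrite /c 2!muln_gt0 (ltnW B0) H0.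
have N_gt0 : (0 < N)%N by rewrite /N muln_gt0 c0.
have cN : (0 < c <= N)%N by rewrite c0 leq_pmulr.
pose phi (k : 'I_H) : wtree s N m -> R :=
  backbone_weight (1 - (k.+1%:R / (B * H)%:R) ^+ 2) c (H %/ k.+1) H.
(* Dominating function: the layers, with factor [6 = 3 * 2], on good trees, and the trivial bound
   [n ^ 2 <= 9 H ^ 2] on trees with a tie or a low vertex. *)
pose g (t : wtree s N m) : R :=
  9 * (1 + \sum_(k < H) 6 * k.+1%:R * phi k t) +
  9 * H%:R ^+ 2 * ((tie t)%:R + (low_vertex c H t)%:R).
have z01 (k : 'I_H) : 0 <= (1 - (k.+1%:R / (B * H)%:R) ^+ 2 : R) <= 1.
  have BH0 : 0 < (B * H)%:R :> R by rewrite ltr0n muln_gt0 (ltnW B0) H0.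
  rewrite gerBl sqr_ge0 andbT subr_ge0 expr_le1 ?divr_ge0//.
  rewrite ler_pdivrMr// mul1r ler_nat.
  by rewrite (leq_trans (ltn_ord k))// leq_pmull// ltnW.
have phi0 k t : 0 <= phi k t by apply: backbone_weight_ge0.
have sum0 t : 0 <= \sum_(k < H) 6 * k.+1%:R * phi k t.
  by apply: sumr_ge0 => k _; rewrite !mulr_ge0.
have g0 t : 0 <= g t.
  by rewrite addr_ge0 ?mulr_ge0 ?sqr_ge0 ?addr_ge0.
have n9 : n%:R ^+ 2 <= 9 * H%:R ^+ 2 :> R.
  by rewrite -!natrX -natrM ler_nat (_ : 9 = 3 ^ 2)%N// -expnMn leq_exp2r// n3H.
have fg x : n%:R ^+ 2 / (count n x)%:R <= g (config w N_gt0 m x).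
  rewrite /g; set t := config _ _ _ _.
  have [bad|] := boolP (tie t || low_vertex c H t).
    apply: le_trans (fn x) _; apply: le_trans n9 _.
    apply: ler_wpDl; first by rewrite mulr_ge0// addr_ge0.
    rewrite ler_peMr ?mulr_ge0 ?sqr_ge0// -natrD ler1n.
    by case/orP: bad => ->; rewrite ?addn1.
  rewrite negb_or => /andP[ntie nlow].
  apply: ler_wpDr; first by rewrite mulr_ge0 ?mulr_ge0 ?sqr_ge0 ?addr_ge0.
  have C0 : (0 < count n x)%N by exact: count_up_to_height_gt0.
  apply: (@le_trans _ _ (9 * (H%:R ^+ 2 / (count n x)%:R))).
    by rewrite mulrA ler_wpM2r ?invr_ge0.
  rewrite ler_wpM2l//; apply: le_trans (sq_layers_le (H := H) _) _.
    apply: (@le_trans _ _ (H%:R ^+ 2)).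
      by rewrite ler_pdivrMr ?ltr0n// ler_peMr ?sqr_ge0// ler1n.
    by apply: lerXn2r; rewrite ?nnegrE// ler_nat.
  rewrite lerD2l; apply: ler_sum => k _.
  apply: le_trans (ler_wpM2l _ (layer_indicator_le R C0 B0 (ltn_ord k))) _.
    exact: mulr_ge0.
  have -> (u : R) : 3 * k.+1%:R * (2 * u) = 6 * k.+1%:R * u by ring.
  rewrite ler_wpM2l ?mulr_ge0//.
  apply: expr_count_le_backbone_weight => //.
  - by move=> e f; exact: grid_homo.
  - exact: leq_addr.
  - by apply: leq_trans n2H; rewrite mul2n -addnn leq_add2l leq_div.
apply: le_trans (ge0_le_integral_dominated P f0 fg) _.
rewrite (integral_config N_gt0 hw g0) lee_fin /g.
rewrite avgD !avgZl !avgD avg_cst ?card_wtree_gt0// avg_sum.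
have sum_le : \sum_(k < H) avg (fun t => 6 * k.+1%:R * phi k t) <=
    12 * decay_constant R s.
  apply: (@le_trans _ _ (\sum_(k < H) 6 * decay_constant R s * (k.+1%:R ^+ 2)^-1)).
    apply: ler_sum => k _; rewrite avgZl.
    have k1 : (0 < k.+1 <= H)%N by rewrite ltn_ord.
    have mm : (s ^ 2 * B * H + H + H <= m)%N.
      by rewrite /m addnC leq_add2l -addnA leq_addl.
    have := @avg_backbone_weight_decay R s H k.+1 N0 m s_gt1 k1 N00 mm.
    move=> /(ler_wpM2l (_ : 0 <= 6 * k.+1%:R)) => h; apply: le_trans (h _) _.
      exact: mulr_ge0.
    have : k.+1%:R != 0 :> R by rewrite pnatr_eq0.
    move: (k.+1%:R : R) (decay_constant R s) => u D u0.
    by rewrite le_eqVlt; apply/orP; left; apply/eqP; field.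
  rewrite -mulr_sumr.
  have := ler_wpM2l (mulr_ge0 (ler0n R 6) D0) (sum_inv_sq_le2 R H); lra.
have H2 : 0 < H%:R ^+ 2 :> R by rewrite exprn_gt0//; lra.
have tie_le : H%:R ^+ 2 * avg (fun t : wtree s N m => (tie t)%:R) <= 1 :> R.
  apply: le_trans (ler_wpM2l (ltW H2) (avg_tie_le R s_gt0 N_gt0 m)) _.
  rewrite mulrA ler_pdivrMr ?ltr0n// mul1r -!natrX -!natrM ler_nat.
  rewrite mulnC -/N0; apply: (@leq_trans c); last exact: leq_pmulr.
  by apply: leq_pmull; rewrite muln_gt0 (ltnW B0) H0.
have low_le : H%:R ^+ 2 * avg (fun t : wtree s N m => (low_vertex c H t)%:R) <= 1 :> R.
  have Hm : (H <= m)%N by exact: leq_addr.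
  apply: le_trans (ler_wpM2l (ltW H2) (avg_low_vertex_le R s N_gt0 Hm cN)) _.
  have -> : c%:R / N%:R = s%:R^-1 :> R.
    by rewrite /N natrM invfM mulrA divff ?mul1r// pnatr_eq0 -lt0n.
  apply: (@le_trans _ _ (H%:R ^+ 2 * (s%:R ^+ H * (s%:R ^+ 2 / (m - H).+1%:R)))).
    rewrite ler_wpM2l ?(ltW H2)// ler_wpM2l ?exprn_ge0//.
    exact: reach_critical_le.
  rewrite !mulrA ler_pdivrMr ?ltr0n// mul1r -!natrX -!natrM ler_nat.
  rewrite /m addKn -(mulnA (H ^ 2 * s ^ H)%N) mulnn (mulnC (H ^ 2)%N) mulnAC.
  by apply: leqW; rewrite -addnA; exact: leq_addr.
(* With [D = decay_constant R s] the total is [9 (1 + 12 D) + 9 (1 + 1) = 27 + 108 D]. *)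
rewrite -[X in _ + X]mulrA mulrDr; lra.
Qed.
End UniformBound.

Theorem theorem1p9 (R : realType) (d : measure_display)
    (T : measurableType d) (P : probability T R)
    (sigma : nat) (hsigma : (2 <= sigma)%N)
    (w : edge sigma -> {RV P >-> R}) (hw : iid_uniform01 w) :
  (ereal_sup (range (fun n : nat =>
     'E_P[fun x : T =>
        (n%:R ^+ 2 /
         (count_up_to_height (invasion_cluster (fun e => w e x)) n)%:R)%R]))
   < +oo)%E.
Proof.
apply: (@le_lt_trans _ _ (27 + 108 * decay_constant R sigma)%:E); last exact: ltry.
apply: ub_ereal_sup => _ [n _ <-]; rewrite unlock.
exact: expected_ratio_le.
Qed.
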